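(* Let $G$ be a countable discrete group. The following statements are equivalent: (i) $G$ is amenable. (ii) There exists a unitary representation $\pi$ of $G$ which has an ONB vector and satisfies $1_G\prec\pi$. (iii) There exists a unitary representation $\pi$ of $G$ which has a Parseval frame vector and satisfies $1_G\prec\pi$. (iv) There exists a unitary representation $\pi$ of $G$ which has a frame vector and satisfies $1_G\prec\pi$. (v) There exists a unitary representation $\pi:G\to\mathcal U(H)$ which has a weak frame vector and satisfies $1_G\prec\pi$. (vi) There exists a unitary representation $\pi:G\to\mathcal U(H)$ with $1_G\prec\pi$ and there exists $w\in H$ such that $\{\pi_g w\}_{g\in G}$ is total (its linear span is dense in $H$) and $\sum_{g\in G}|\langle v,\pi_g w\rangle|^2<\infty$ for all $v$ in a dense subspace of $H$.
   Context: ''Countable'' means countably infinite. All Hilbert spaces are complex and separable; $\mathcal U(H)$ is the group of unitary operators on $H$. Amenability: a countable discrete group $G$ is amenable if there is a left-invariant state on $\ell^\infty(G)$, i.e. a positive linear functional $\varphi:\ell^\infty(G)\to\mathbb C$ taking the value $1$ on the constant function $1$ and invariant under left translation by elements of $G$. $1_G\prec\pi$ (the trivial representation is weakly contained in $\pi$; $\pi$ has almost invariant vectors) means: there is a net $(v_i)_{i\in I}$ of unit vectors in $H$ with $\|\pi_g v_i-v_i\|\to0$ for every $g\in G$. Frames: let $S$ be a countable set and $\{f_n\}_{n\in S}$ a family in a Hilbert space $H$. It is a frame if there are constants $A,B>0$ with $A\|v\|^2\le\sum_{n\in S}|\langle v,f_n\rangle|^2\le B\|v\|^2$ for all $v\in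 H$; a Parseval frame if one can take $A=B=1$; a Bessel sequence if the second inequality holds for some $B>0$ and all $v\in H$; a weak frame if it is a Bessel sequence and is total (its linear span is dense in $H$). For a unitary representation $\pi:G\to\mathcal U(H)$, a vector $\varphi\in H$ is an ONB vector (respectively Parseval frame vector, frame vector, weak frame vector) if the family $\{\pi_g\varphi\}_{g\in G}$ is an orthonormal basis (respectively Parseval frame, frame, weak frame) of $H$. *)

(* Defs.v *)
From HB Require Import structures.
From mathcomp Require Import all_boot all_order all_algebra.
From mathcomp Require Import all_classical all_reals all_analysis.
From mathcomp Require Import complex.

Set Implicit Arguments.
Unset Strict Implicit.
Unset Printing Implicit Defensive.

Import Order.TTheory GRing.Theory Num.Theory.
Import numFieldNormedType.Exports.

Local Open Scope classical_set_scope.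
Local Open Scope ring_scope.
Local Open Scope complex_scope.

(* The regular module R[i]^o, rather than R[i], carries the topology and the
   module structure of the complex numbers. *)
Definition linfty_pred (R : realType) (G : Type) : {pred G -> R[i]^o} :=
  fun f => `[< bounded_fun f >].
Arguments linfty_pred : clear implicits.

Lemma linfty_predP (R : realType) (G : Type) (f : G -> R[i]^o) :
  reflect (exists M : R[i], forall x, `|f x| <= M) (f \in linfty_pred R G).
Proof.
apply: (iffP (asboolP _)) => [[M [Mr HM]]|[M HM]].
  by exists (M + 1) => x; apply: HM => //; rewrite ltrDl.
have [[x _]|G0] := pselect (exists x : G, True).
  exists M; split => [|N MN y _ /=].
    exact: ger0_real (le_trans (normr_ge0 _) (HM x)).
  exact: le_trans (HM y) (ltW MN).
by exists 0; split => // N _ y; case: G0; exists y.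
Qed.

Lemma linfty_submod_closed (R : realType) (G : Type) :
  submod_closed (linfty_pred R G).
Proof.
split=> [|a f g /linfty_predP[M HM] /linfty_predP[N HN]]; apply/linfty_predP.
  by exists 0 => x; rewrite normr0.
exists (`|a| * M + N) => x; apply: (le_trans (ler_normD _ _)).
by rewrite lerD ?HN// normrM ler_wpM2l.
Qed.

HB.instance Definition _ (R : realType) (G : Type) :=
  GRing.isSubmodClosed.Build R[i] (G -> R[i]^o) (linfty_pred R G)
    (linfty_submod_closed R G).

Record linfty (R : realType) (G : Type) := Linfty {
  linfty_fun :> G -> R[i]^o;
  linfty_bounded : linfty_fun \in linfty_pred R G }.

HB.instance Definition _ (R : realType) (G : Type) :=
  [isSub for @linfty_fun R G].
HB.instance Definition _ (R : realType) (G : Type) :=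
  [Choice of linfty R G by <:].
HB.instance Definition _ (R : realType) (G : Type) :=
  [SubChoice_isSubLmodule of linfty R G by <:].

Section Amenability.
Variables (R : realType) (G : groupType).

Lemma linfty1_subproof : (fun _ : G => 1 : R[i]^o) \in linfty_pred R G.
Proof. by apply/linfty_predP; exists 1 => x; rewrite normr1. Qed.

Definition linfty1 : linfty R G := Linfty linfty1_subproof.

Lemma ltrans_subproof (g : G) (f : linfty R G) :
  (fun x : G => f (g^-1 * x)%g) \in linfty_pred R G.
Proof.
by have /linfty_predP[M HM] := linfty_bounded f; apply/linfty_predP; exists M.
Qed.

Definition ltrans (g : G) (f : linfty R G) : linfty R G :=
  Linfty (ltrans_subproof g f).

(* In R[i], 0 <= z means that z is real and nonnegative. *)
Definition positive_functional (phi : {scalar linfty R G}) :=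
  forall f : linfty R G, (forall x, 0 <= f x) -> 0 <= phi f.

Definition amenable := exists phi : {scalar linfty R G},
  [/\ positive_functional phi, phi linfty1 = 1
    & forall g f, phi (ltrans g f) = phi f].

End Amenability.

(* The inner product is linear in its first argument and conjugate-linear in
   the second one. *)
Record hilbertSpace (R : realType) := HilbertSpace {
  hilbert_sort :> completeNormedModType R[i];
  inner : {dot hilbert_sort for @Num.conj R[i]};
  inner_norm : forall v : hilbert_sort, inner v v = `|v| ^+ 2;
  hilbert_separable :
    exists D : set hilbert_sort, countable D /\ dense D }.

Arguments inner {R h}.

Definition linear_span (R : realType) (H : hilbertSpace R) (S : Type)
    (f : S -> H) : set H :=
  [set v | exists (s : seq S) (c : S -> R[i]), v = \sum_(n <- s) c n *: f n].

(* Squared moduli and norms are elements of R[i]; Re turns them into reals, so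
   that sums over an arbitrary index set can be taken in \bar R. *)
Section Frames.
Variables (R : realType) (H : hilbertSpace R) (S : choiceType) (f : S -> H).

Definition frame_sum (v : H) : \bar R :=
  (\esum_(n in [set: S]) (complex.Re (`|inner v (f n)| ^+ 2))%:E)%E.

Definition lower_frame_bound (A : R) :=
  forall v : H, ((A * complex.Re (`|v| ^+ 2))%:E <= frame_sum v)%E.

Definition upper_frame_bound (B : R) :=
  forall v : H, (frame_sum v <= (B * complex.Re (`|v| ^+ 2))%:E)%E.

Definition frame := exists A B : R,
  [/\ 0 < A, 0 < B, lower_frame_bound A & upper_frame_bound B].

Definition parseval_frame := lower_frame_bound 1 /\ upper_frame_bound 1.

Definition bessel := exists2 B : R, 0 < B & upper_frame_bound B.

Definition total_family := dense (linear_span f).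

Definition weak_frame := bessel /\ total_family.

Definition orthonormal_basis :=
  (forall m n, inner (f m) (f n) = (m == n)%:R) /\ total_family.

End Frames.

Definition unitary_operator (R : realType) (H : hilbertSpace R)
    (T : {linear H -> H}) :=
  (forall u v, inner (T u) (T v) = inner u v) /\ (forall w, exists v, T v = w).

Record unitary_rep (R : realType) (G : groupType) (H : hilbertSpace R) :=
  UnitaryRep {
    rep :> G -> {linear H -> H};
    rep_unitary : forall g, unitary_operator (rep g);
    repM : forall (g h : G) (v : H), rep (g * h)%g v = rep g (rep h v) }.

Definition directed (I : Type) (le : I -> I -> Prop) :=
  [/\ inhabited I, forall i, le i i,
      forall i j k, le i j -> le j k -> le i k
    & forall i j, exists k, le i k /\ le j k].

Definition net_filter (I : Type) (le : I -> I -> Prop) : set_system I :=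
  filter_from [set: I] (fun i => [set j | le i j]).

Section Representations.
Variables (R : realType) (G : groupType) (H : hilbertSpace R).
Variable pi : unitary_rep G H.

Definition trivial_weakly_contained :=
  exists (I : Type) (le : I -> I -> Prop) (v : I -> H),
    [/\ directed le, forall i, `|v i| = 1
      & forall g, (`|pi g (v i) - v i| : R[i]^o) @[i --> net_filter le] --> 0].

Definition orbit_family (w : H) : G -> H := fun g => pi g w.

Definition onb_vector (w : H) := orthonormal_basis (orbit_family w).
Definition parseval_frame_vector (w : H) := parseval_frame (orbit_family w).
Definition frame_vector (w : H) := frame (orbit_family w).
Definition weak_frame_vector (w : H) := weak_frame (orbit_family w).

End Representations.

(* Main.v *)
Require Import Defs.
From HB Require Import structures.
From mathcomp Require Import all_boot all_order all_algebra.
From mathcomp Require Import all_classical all_reals all_analysis.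
From mathcomp Require Import complex ring lra.
Set Implicit Arguments.
Unset Strict Implicit.
Unset Printing Implicit Defensive.
Import Order.TTheory GRing.Theory Num.Theory.
Import numFieldNormedType.Exports.
Local Open Scope classical_set_scope.
Local Open Scope ring_scope.

(** The implications from an orthonormal basis down to a total orbit with dense
    square summability only weaken the hypothesis on the vector; the two that
    matter join amenability to almost invariant vectors of the regular
    representation on square summable functions.

    Suppose that a representation on [H] has almost invariant vectors and a
    vector [w] with total orbit such that [v |-> (<v, pi g w>)_g] is square
    summable for [v] in a dense subspace. This analysis operator is an
    injective, densely defined and closed intertwiner towards the regular
    representation. It may be unbounded; the classical remedy is the polar
    decomposition, which embeds [H] in the regular representation. It is avoided
    here. Give the domain the graph norm; the adjoint of the analysis operator,
    for this norm, is an equivariant contraction from square summable functions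
    to [H] with dense range ([graph_adjoint_le], [graph_adjoint_dense]). Its
    values come from the Riesz theorem on the graph. If the regular
    representation had no almost invariant vectors, then for some finite list of
    group elements the operator [averaging], one minus a multiple of the
    Laplacian of the list, would have norm [q < 1] on square summable functions.
    Its iterates on a vector [x] in the range of the contraction then decay like
    [C * q ^+ n], with [C] depending on [x]; as the operator is self-adjoint the
    square norms of the iterates are log-convex, so that already the first step
    contracts by [q] ([displacement_transfer]). Density leaves no almost
    invariant vectors in [H], a contradiction. Finally, unit vectors [c] of the
    regular representation yield means [f |-> sum_x f x * `|c x| ^+ 2], and an
    ultrafilter limit along almost invariant vectors is an invariant mean.

    Conversely let the group be amenable. Either some finitely supported
    probability density is moved by less than [eps], in total l1 distance, by
    the given group elements, and its square root is an almost invariant vector;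
    or the displacements of the point masses generate a convex cone on which the
    l1 norm is at least [eps] times the mass. In the second case the Hahn-Banach
    theorem separates the cone from [0] and gives bounded functions [f k] with
    [eps <= sum_k (f k (g k * x) - f k x)] at every [x], which the invariant mean
    contradicts ([reiter]).

    Group elements are numbered by a bijection with the natural numbers, so that
    a single Hilbert space of sequences carries the regular representation. *)

(** * Real forms and almost minimisers *)

Section RealForms.
Variables (R : realType) (V : lmodType R[i]).
Implicit Types (r : V -> V -> R) (W : V -> Prop) (phi : V -> R).

(** What remains of a positive semidefinite hermitian form when only its real
    part is kept: minimisation and order arguments never see more. *)
Definition real_form r :=
  [/\ forall u v w, r (u + v) w = r u w + r v w,
      forall (c : R) u w, r (c%:C%C *: u) w = c * r u w,
      forall u v, r u v = r v u
    & forall u, 0 <= r u u].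

Definition is_subspace W :=
  [/\ W 0, forall u v, W u -> W v -> W (u + v)
    & forall (c : R[i]) u, W u -> W (c *: u)].

Lemma real_form_sq r : real_form r -> forall (t : R) u v,
  r (u + t%:C%C *: v) (u + t%:C%C *: v) =
    r u u + t * (2 * r u v) + t ^+ 2 * r v v.
Proof.
move=> [rD rZ rC _] t u v.
rewrite rD rZ ![r _ (_ + _)]rC !rD !rZ [r v u]rC; ring.
Qed.

Lemma discr_le (a b c : R) : 0 <= a ->
  (forall t, 0 <= c + t * (2 * b) + t ^+ 2 * a) -> b ^+ 2 <= a * c.
Proof.
rewrite le_eqVlt => /orP[/eqP <- h|a0 h].
  rewrite mul0r; have [->|b0] := eqVneq b 0; first by rewrite expr0n.
  have := h (- (c + 1) / (2 * b));
    rewrite mulr0 addr0 divfK ?mulf_neq0 ?pnatr_eq0//.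
  by move=> h1; exfalso; lra.
have := h (- b / a).
have -> : c + - b / a * (2 * b) + (- b / a) ^+ 2 * a = c - b ^+ 2 / a.
  by field; rewrite gt_eqF.
by rewrite subr_ge0 ler_pdivrMr// mulrC.
Qed.

Lemma cauchy_schwarz r : real_form r ->
  forall u v, r u v ^+ 2 <= r u u * r v v.
Proof.
move=> rf u v; rewrite mulrC; have [_ _ _ r0] := rf.
by apply: discr_le => // t; rewrite -real_form_sq.
Qed.

Lemma real_formBr r : real_form r ->
  forall v p q, r v (p - q) = r v p - r v q.
Proof.
move=> [rD rZ rC _] v p q; rewrite rC rD -scaleN1r.
have -> : - 1 = (- 1 : R)%:C%C by rewrite rmorphN.
by rewrite rZ mulN1r !(rC v).
Qed.

(** A bounded functional on a subspace is almost represented by the vectors that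
    almost minimise [r v v - 2 * phi v]: where this quantity is within [d] of
    its infimum, its first variation in the direction [v] has square at most
    [r v v * d]. With limits left to [riesz_limit], the same statement serves
    for a Hilbert space and for the graph of an unbounded operator. *)
Lemma riesz_seq r W phi (K : R) : real_form r -> is_subspace W -> 0 <= K ->
  (forall u v, W u -> W v -> phi (u + v) = phi u + phi v) ->
  (forall (c : R) u, W u -> phi (c%:C%C *: u) = c * phi u) ->
  (forall u, W u -> phi u ^+ 2 <= K * r u u) ->
  exists w : nat -> V, [/\ forall n, W (w n),
    forall n v, W v -> (phi v - r v (w n)) ^+ 2 <= r v v / n.+1%:R
  & forall e, 0 < e -> exists N, forall m n, (N <= m)%N -> (N <= n)%N ->
      r (w m - w n) (w m - w n) < e].
Proof.
move=> rf [W0 WD WZ] K0 pD pZ pK; have [_ _ rC r0] := rf.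
pose F v := r v v - 2 * phi v.
pose E := [set F v | v in W].
(* If [r v v - 2 * phi v] were below [- K], then [2 * phi v] would exceed
   [r v v + K], which is at least twice the square root of [K * r v v]. *)
have Flb v : W v -> - K <= F v.
  move=> Wv; have := pK _ Wv; have := r0 v; rewrite /F => r0v pk.
  rewrite leNgt; apply/negP => h.
  have h0 : 0 <= r v v + K by rewrite addr_ge0.
  have : (r v v + K) ^+ 2 < (2 * phi v) ^+ 2.
    by rewrite ltr_pXn2r// ?nnegrE; lra.
  by have := sqr_ge0 (r v v - K); lra.
have Einf : has_inf E.
  by split; [exists (F 0), 0|exists (- K) => _ [v Wv <-]; exact: Flb].
have /choice[w Hw] : forall n : nat, exists x, W x /\ F x < inf E + n.+1%:R^-1.
  move=> n; have n0 : 0 < n.+1%:R^-1 :> R by rewrite invr_gt0.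
  by have [_ [x Wx <-] Fx] := inf_adherent n0 Einf; exists x.
have wP n v : W v -> (phi v - r v (w n)) ^+ 2 <= r v v / n.+1%:R.
  move=> Wv.
  have [Wn Fn] := Hw n.
  rewrite -sqrrN opprB; apply: discr_le => // t.
  have Wt : W (w n + t%:C%C *: v) by apply: WD => //; exact: WZ.
  have : inf E <= F (w n + t%:C%C *: v) by apply: ge_inf => //;
    [case: Einf|exists (w n + t%:C%C *: v)].
  move: Fn; rewrite /F real_form_sq// pD// ?pZ//; last exact: WZ.
  rewrite [r (w n) v]rC; move: (n.+1%:R^-1) (inf E) => q m h1 h2; lra.
exists w; split=> [n|//|e e0]; first by case: (Hw n).
(* Two almost representatives differ little when tested on their difference. *)
have [N HN] : exists N : nat, 8 / e < N.+1%:R.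
  by exists (Num.truncn (8 / e)); exact: truncnS_gt.
exists N => m n Nm Nn; set d := w m - w n.
have Wd : W d.
  apply: WD; first by case: (Hw m).
  by rewrite -scaleN1r; apply: WZ; case: (Hw n).
have dE : r d (w m) - r d (w n) = r d d by rewrite -real_formBr.
have h := wP m d Wd; have h' := wP n d Wd.
have k0 k : (N <= k)%N -> r d d / k.+1%:R <= r d d * (e / 8).
  move=> Nk; rewrite ler_wpM2l// -[e / 8]invrK lef_pV2 ?posrE ?invr_gt0
    ?divr_gt0//.
  by rewrite invf_div (le_trans (ltW HN))// ler_nat.
have := k0 m Nm; have := k0 n Nn => hn hm.
have rd2 : r d d ^+ 2 <= 4 * (r d d * (e / 8)).
  rewrite -[in leLHS]dE; have :=
    sqr_ge0 (phi d - r d (w m) + (phi d - r d (w n))).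
  move: (phi d) (r d (w m)) (r d (w n)) h h' hm hn;
    move: (r d d / _) (r d d / _).
  by move: (r d d * (e / 8)) => *; lra.
have [->//|rd0] := eqVneq (r d d) 0.
have rp : 0 < r d d by rewrite lt_def rd0 r0.
have : r d d <= e / 2 by rewrite -(ler_pM2l rp); lra.
by lra.
Qed.

(** A limit [p] of almost representatives represents the functional exactly;
    completeness of the space at hand provides it. *)
Lemma riesz_limit r (w : nat -> V) (p v : V) (phi_v : R) : real_form r ->
  (forall n, (phi_v - r v (w n)) ^+ 2 <= r v v / n.+1%:R) ->
  (forall e, 0 < e -> exists N, forall n, (N <= n)%N ->
     r (w n - p) (w n - p) < e) ->
  phi_v = r v p.
Proof.
move=> rf wP wp; have [_ _ rC r0] := rf.
apply/eqP; rewrite -subr_eq0 -sqrf_eq0 eq_le sqr_ge0 andbT.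
apply/ler_addgt0Pl => e e0; rewrite addr0.
have q0 : 0 < 4 * (r v v + 1) by rewrite mulr_gt0// ltr_wpDl.
have [N1 H1] := wp _ (divr_gt0 e0 q0).
have [N2 HN2] : exists N : nat, 4 * r v v / e < N.+1%:R.
  by exists (Num.truncn (4 * r v v / e)); exact: truncnS_gt.
set n := maxn N1 N2.
have h1 : (r v (w n) - r v p) ^+ 2 <= e / 4.
  have := H1 n (leq_maxl _ _); rewrite ltr_pdivlMr// => h1.
  rewrite -real_formBr//; apply: le_trans (cauchy_schwarz rf _ _) _.
  by have := r0 (w n - p); lra.
have h2 := wP n.
have h3 : r v v / n.+1%:R <= e / 4.
  rewrite ler_pdivrMr// mulrC.
  have : 4 * r v v / e <= n.+1%:R.
    by rewrite (le_trans (ltW HN2))// ler_nat ltnS leq_maxr.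
  by rewrite ler_pdivrMr// => ?; lra.
have := sqr_ge0 ((phi_v - r v (w n)) - (r v (w n) - r v p)).
by move: (r v v / _) h2 h3 => q; lra.
Qed.

End RealForms.

(** * Hilbert spaces *)

Section ComplexSquare.
Variable R : realType.
Implicit Types z : R[i].

(** Squared moduli, as reals, are polynomials in the real and imaginary parts,
    which keeps square roots out of the estimates. *)
Definition sqm z : R := complex.Re z ^+ 2 + complex.Im z ^+ 2.

Lemma sqmE z : `|z| ^+ 2 = (sqm z)%:C%C.
Proof. by rewrite add_Re2_Im2. Qed.

Lemma sqm_ge0 z : 0 <= sqm z.
Proof. by rewrite addr_ge0 ?sqr_ge0. Qed.

Lemma sqmM z1 z2 : sqm (z1 * z2) = sqm z1 * sqm z2.
Proof. case: z1 z2 => [a b] [c d]; rewrite /sqm /=; ring. Qed.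

Lemma sqm_eq0 z : sqm z = 0 -> z = 0.
Proof.
by move=> z0; apply/eqP; rewrite -normr_eq0 -sqrf_eq0 sqmE z0.
Qed.

Lemma conjE z : z^* = conjc z. Proof. by []. Qed.

Lemma ReM_real (c : R) z : complex.Re (c%:C%C * z) = c * complex.Re z.
Proof. by case: z => a b /=; rewrite mul0r subr0. Qed.

Lemma ge0_real z : 0 <= z -> z = (complex.Re z)%:C%C.
Proof. by move=> z0; rewrite RRe_real// ger0_real. Qed.

Lemma ReD z1 z2 : complex.Re (z1 + z2) = complex.Re z1 + complex.Re z2.
Proof. by case: z1 z2 => [a b] [c d]. Qed.
Lemma ImD z1 z2 : complex.Im (z1 + z2) = complex.Im z1 + complex.Im z2.
Proof. by case: z1 z2 => [a b] [c d]. Qed.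

End ComplexSquare.

Section HilbertBasics.
Variables (R : realType) (H : hilbertSpace R).
Implicit Types (u v w : H).

Definition rdot u v : R := complex.Re (inner u v).
Definition nsq u : R := rdot u u.

Lemma innerC u v : inner u v = (inner v u)^*.
Proof. by rewrite hermC expr0 mul1r. Qed.

Lemma innerDl u v w : inner (u + v) w = inner u w + inner v w.
Proof. by rewrite linearDl. Qed.
Lemma innerZl c u w : inner (c *: u) w = c * inner u w.
Proof. by rewrite linearZl_LR. Qed.
Lemma innerZr c u w : inner w (c *: u) = c^* * inner w u.
Proof. by rewrite linearZr_LR. Qed.

Lemma real_form_rdot : real_form rdot.
Proof.
split => [u v w|c u w|u v|u]; rewrite /rdot.
- by rewrite innerDl ReD.
- by rewrite innerZl ReM_real.
- by rewrite innerC; case: (inner v u).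
- by have := dnorm_ge0 inner u; rewrite lecE => /andP[].
Qed.

Lemma nsqE v : inner v v = (nsq v)%:C%C.
Proof. by apply: ge0_real; exact: dnorm_ge0. Qed.

Lemma nsq_ge0 v : 0 <= nsq v.
Proof. by have [_ _ _] := real_form_rdot; apply. Qed.

Lemma normE v : `|v| ^+ 2 = (nsq v)%:C%C.
Proof. by rewrite -inner_norm nsqE. Qed.

Lemma nsq_lt v (e : R) : 0 < e -> (`|v| < e%:C%C) = (nsq v < e ^+ 2).
Proof.
move=> e0; rewrite -ltcR -normE rmorphXn/= ltr_pXn2r// nnegrE ?normr_ge0//.
by rewrite ler0c ltW.
Qed.

Lemma nsq_eq0 v : nsq v = 0 -> v = 0.
Proof.
by move=> v0; apply/eqP; rewrite -(dnorm_eq0 inner) nsqE v0.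
Qed.

Lemma Im_inner u v : complex.Im (inner u v) = - rdot ('i%C *: u) v.
Proof. by rewrite /rdot innerZl; case: (inner u v) => a b/=;
  rewrite mul0r mul1r sub0r opprK. Qed.

Lemma inner_eq0 u v :
  rdot u v = 0 -> rdot ('i%C *: u) v = 0 -> inner u v = 0.
Proof.
move=> h1 h2; apply/eqP; rewrite eq_complex Im_inner h2 oppr0 /= eqxx andbT.
by rewrite -[complex.Re _]/(rdot u v) h1.
Qed.

Lemma nsqZ c v : nsq (c *: v) = sqm c * nsq v.
Proof.
by apply: complexI; rewrite rmorphM/= -!normE -sqmE normrZ exprMn.
Qed.

Lemma nsqN v : nsq (- v) = nsq v.
Proof. by apply: complexI; rewrite -!normE normrN. Qed.

Lemma rdotDl u v w : rdot (u + v) w = rdot u w + rdot v w.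
Proof. by have [->] := real_form_rdot. Qed.
Lemma rdotC u v : rdot u v = rdot v u.
Proof. by have [_ _ ->] := real_form_rdot. Qed.
Lemma rdotDr u v w : rdot w (u + v) = rdot w u + rdot w v.
Proof. by rewrite rdotC rdotDl !(rdotC w). Qed.
Lemma rdotNl u w : rdot (- u) w = - rdot u w.
Proof. by rewrite -scaleN1r /rdot innerZl mulN1r; case: (inner u w). Qed.
Lemma rdotNr u w : rdot w (- u) = - rdot w u.
Proof. by rewrite rdotC rdotNl rdotC. Qed.

Lemma nsqD u v : nsq (u + v) = nsq u + nsq v + 2 * rdot u v.
Proof. rewrite /nsq rdotDl !rdotDr (rdotC v u); ring. Qed.

Lemma nsqB u v : nsq (u - v) = nsq u + nsq v - 2 * rdot u v.
Proof. by rewrite nsqD nsqN rdotNr; ring. Qed.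

Lemma nsqD_le u v : nsq (u + v) <= 2 * nsq u + 2 * nsq v.
Proof. by have := nsq_ge0 (u - v); rewrite nsqB nsqD; lra. Qed.

Lemma nsqBC u v : nsq (u - v) = nsq (v - u).
Proof. by rewrite -opprB nsqN. Qed.

Lemma rdot_le u v : rdot u v ^+ 2 <= nsq u * nsq v.
Proof. exact: (cauchy_schwarz real_form_rdot). Qed.

(** Rotating [u] so that the inner product becomes a positive real reduces the
    complex Cauchy-Schwarz inequality to the real one. *)
Lemma sqm_inner_le u v : sqm (inner u v) <= nsq u * nsq v.
Proof.
set z := inner u v; have [->|z0] := eqVneq (sqm z) 0.
  by rewrite mulr_ge0 ?nsq_ge0.
have zp : 0 < sqm z by rewrite lt_def z0 sqm_ge0.
have := rdot_le (z^* *: u) v.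
rewrite nsqZ {1}/rdot innerZl -/z.
have -> : complex.Re (z^* * z) = sqm z.
  by rewrite conjE; case: (z) => a b; rewrite /sqm/=; ring.
have -> : sqm (z^*) = sqm z by rewrite conjE; case: (z) => a b; rewrite /sqm/=;
  ring.
by rewrite expr2 -mulrA ler_pM2l.
Qed.

Definition hilbert_cvg (w : nat -> H) (p : H) :=
  forall e : R, 0 < e -> exists N, forall n, (N <= n)%N -> nsq (w n - p) < e.

Lemma hilbert_complete (w : nat -> H) :
  (forall e : R, 0 < e -> exists N, forall m n, (N <= m)%N -> (N <= n)%N ->
     nsq (w m - w n) < e) ->
  exists p, hilbert_cvg w p.
Proof.
move=> cw.
have : cvg (w @ \oo).
  apply/cauchy_cvgP/cauchyP => e e0.
  have eR : e = (complex.Re e)%:C%C by apply: ge0_real; exact: ltW.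
  have e0' : 0 < complex.Re e by rewrite -ltcR -eR.
  have [N HN] := cw _ (exprn_gt0 2 e0').
  exists (w N); exists N => // n /= Nn.
  rewrite -ball_normE /ball_/= eR nsq_lt//.
  exact: HN.
case/cvg_ex => p wp; exists p => e e0.
have s0 : 0 < Num.sqrt e by rewrite sqrtr_gt0.
have /cvgrPdist_lt/(_ (Num.sqrt e)%:C%C) := wp.
rewrite ltcR => /(_ s0) [N _ HN].
exists N => n Nn; have := HN n Nn => /=.
by rewrite nsq_lt// sqr_sqrtr ?ltW// nsqBC.
Qed.

Lemma dense_seqP (W : set H) : dense W <->
  forall y (e : R), 0 < e -> exists w, W w /\ nsq (w - y) < e.
Proof.
have sq e : 0 < e -> 0 < Num.sqrt e :> R by rewrite sqrtr_gt0.
split => [dW y e e0|hW O [y Oy] oO].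
  have sC : 0 < (Num.sqrt e)%:C%C :> R[i] by rewrite ltcR sq.
  have [|z [/interior_subset + Wz]] :=
    dW _ _ (open_interior (ball y (Num.sqrt e)%:C%C)).
    by exists y; exact: nbhsx_ballx.
  rewrite -ball_normE /ball_/= nsq_lt ?sq// sqr_sqrtr ?ltW// => zy.
  by exists z; rewrite nsqBC.
have /nbhs_ballP[d d0 dO] : nbhs y O by exact: open_nbhs_nbhs.
have dR : d = (complex.Re d)%:C%C by apply: ge0_real; exact: ltW.
have d0' : 0 < complex.Re d by rewrite -ltcR -dR.
have [z [Wz zy]] := hW y _ (exprn_gt0 2 d0').
exists z; split => //; apply: dO.
by rewrite -ball_normE /ball_/= dR nsq_lt// nsqBC.
Qed.

(** The subspace need not be closed: the representative is only a limit of
    vectors of [W]. *)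
Lemma hilbert_riesz (W : H -> Prop) (phi : H -> R) (K : R) :
  is_subspace W -> 0 <= K ->
  (forall u v, W u -> W v -> phi (u + v) = phi u + phi v) ->
  (forall (c : R) u, W u -> phi (c%:C%C *: u) = c * phi u) ->
  (forall u, W u -> phi u ^+ 2 <= K * nsq u) ->
  exists p (w : nat -> H), [/\ forall n, W (w n), hilbert_cvg w p
    & forall v, W v -> phi v = rdot v p].
Proof.
move=> Ws K0 pD pZ pK.
have [w [Ww wP wC]] := riesz_seq real_form_rdot Ws K0 pD pZ pK.
have [p wp] := hilbert_complete wC.
exists p, w; split => // v Wv.
by apply: (riesz_limit real_form_rdot _ wp) => n; exact: wP.
Qed.

(** If only [0] is orthogonal to a subspace, the limit which represents the
    functional [rdot _ y] on that subspace is [y] itself. *)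
Lemma dense_orth0 (W : H -> Prop) : is_subspace W ->
  (forall y, (forall w, W w -> inner w y = 0) -> y = 0) -> dense W.
Proof.
move=> Ws h; apply/dense_seqP => y e e0.
have [p [w [Ww wp pE]]] := @hilbert_riesz W (rdot^~ y) (nsq y) Ws (nsq_ge0 _)
  (fun u v _ _ => rdotDl u v y) (fun c u _ => let: And4 _ z _ _ :=
    real_form_rdot in z c u y)
  (fun u _ => eq_ind_r (fun z => _ <= z) (rdot_le u y) (mulrC _ _)).
have yp : y = p.
  apply/eqP; rewrite -subr_eq0; apply/eqP; apply: h => v Wv.
  have Wiv : W ('i%C *: v) by have [_ _] := Ws; apply.
  by apply: inner_eq0; rewrite rdotDr rdotNr pE// subrr.
have [N HN] := wp e e0; exists (w N); split => //.
by rewrite yp; exact: HN.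
Qed.

End HilbertBasics.

(** * Frames *)

Section FrameTheory.
Variables (R : realType) (H : hilbertSpace R) (S : choiceType) (f : S -> H).
Implicit Types (u v : H).

Lemma Re_normsq (z : R[i]) : complex.Re (`|z| ^+ 2) = sqm z.
Proof. by rewrite sqmE. Qed.

Lemma Re_normsqH v : complex.Re (`|v| ^+ 2) = nsq v.
Proof. by rewrite normE. Qed.

Lemma frame_sumE v :
  frame_sum f v = (\esum_(n in [set: S]) (sqm (inner v (f n)))%:E)%E.
Proof. by apply: eq_esum => n _; rewrite Re_normsq. Qed.

(** Coefficients are attached to the indices, so two combinations can be added
    only after each index has been made to occur once. *)
Lemma linear_span_uniq v : linear_span f v ->
  exists (s : seq S) (c : S -> R[i]), uniq s /\ v = \sum_(n <- s) c n *: f n.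
Proof.
move=> [s [c ->]]; exists (undup s), (fun n => c n *+ count_mem n s).
split; first exact: undup_uniq.
rewrite -big_undup_iterop_count/=; apply: eq_bigr => i _.
by rewrite -scalerMnl.
Qed.

Lemma linear_span_gen n : linear_span f (f n).
Proof. by exists [:: n], (fun _ => 1); rewrite big_seq1 scale1r. Qed.

Lemma linear_span_subspace : is_subspace (linear_span f : H -> Prop).
Proof.
(* A combination extends by zero coefficients to a larger list of indices. *)
have ext (s t : seq S) (c : S -> R[i]) : uniq s -> uniq t -> {subset s <= t} ->
    \sum_(n <- s) c n *: f n = \sum_(n <- t) (if n \in s then c n else 0) *: f
      n.
  move=> us ut st; rewrite [RHS](bigID (mem s))/= [X in _ + X]big1 ?addr0.
    under [RHS]eq_bigr => n -> do [].
    rewrite -[RHS]big_filter.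
    apply: perm_big; apply: uniq_perm; rewrite ?filter_uniq// => n.
    by rewrite mem_filter; case: (boolP (n \in s)) => //= /st ->.
  by move=> n /negbTE ->; rewrite scale0r.
split=> [|u v|a u].
- by exists [::], (fun _ => 0); rewrite big_nil.
- move=> /linear_span_uniq[s [c [us ->]]] /linear_span_uniq[t [d [ut ->]]].
  exists (undup (s ++ t)), (fun n =>
    (if n \in s then c n else 0) + (if n \in t then d n else 0)).
  rewrite (ext s (undup (s ++ t)))// ?undup_uniq//; last first.
    by move=> n ns; rewrite mem_undup mem_cat ns.
  rewrite (ext t (undup (s ++ t)))// ?undup_uniq//; last first.
    by move=> n ns; rewrite mem_undup mem_cat ns orbT.
  by rewrite -big_split/=; apply: eq_bigr => n _; rewrite scalerDl.
- move=> [s [c ->]]; exists s, (fun n => a * c n).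
  by rewrite scaler_sumr; apply: eq_bigr => n _; rewrite scalerA.
Qed.

Lemma total_orth0 y : total_family f -> (forall n, inner y (f n) = 0) -> y = 0.
Proof.
move=> /dense_seqP tf yf; apply: nsq_eq0; apply/eqP.
rewrite eq_le nsq_ge0 andbT; apply/ler_addgt0Pl => e e0; rewrite addr0.
have [w [[s [c wE]] we]] := tf y e e0.
have : rdot y w = 0.
  rewrite /rdot wE linear_sumr/= big1// => n _.
  by rewrite innerZr yf mulr0.
by move=> h; move: we; rewrite nsqB (rdotC w) h; have := nsq_ge0 w; lra.
Qed.

Lemma orth0_total : (forall y, (forall n, inner y (f n) = 0) -> y = 0) ->
  total_family f.
Proof.
move=> h; apply: (dense_orth0 linear_span_subspace) => y yf; apply: h => n.
by rewrite innerC yf ?rmorph0//; exact: linear_span_gen.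
Qed.

(** Expanding the square of a distance to a combination and completing the square
    in each coefficient. *)
Lemma nsq_sub_orthonormal (s : seq S) (c : S -> R[i]) v :
  (forall m n, inner (f m) (f n) = (m == n)%:R) -> uniq s ->
  nsq (v - \sum_(n <- s) c n *: f n) =
  nsq v - \sum_(n <- s) sqm (inner v (f n))
        + \sum_(n <- s) sqm (inner v (f n) - c n).
Proof.
move=> of_; elim: s => [|a s IH] /=;
  first by rewrite !big_nil subr0 addr0 subr0.
move=> /andP[as_ us]; rewrite !big_cons.
have -> : v - (c a *: f a + \sum_(j <- s) c j *: f j) =
          (v - \sum_(j <- s) c j *: f j) - c a *: f a.
  by rewrite opprD addrCA addrC.
set x := v - _ in IH *; rewrite nsqB IH// nsqZ.
have -> : nsq (f a) = 1 by rewrite /nsq /rdot of_ eqxx.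
have -> : rdot x (c a *: f a) = complex.Re ((c a)^* * inner v (f a)).
  rewrite /rdot innerZr; congr (complex.Re (_ * _)).
  rewrite /x innerDl -scaleN1r innerZl mulN1r linear_sumlz/= big1_seq ?subr0//.
  move=> n /andP[_ ns]; rewrite innerZl of_ (_ : n == a = false) ?mulr0//.
  by apply/negP => /eqP na; rewrite -na ns in as_.
rewrite conjE /sqm; case: (c a) (inner v (f a)) => [b d] [g h] /=; ring.
Qed.

(** In [nsq_sub_orthonormal] the coefficients [<v, f n>] give Bessel's
    inequality, and those of a combination close to [v] give the converse. *)
Lemma orthonormal_basis_parseval : orthonormal_basis f -> parseval_frame f.
Proof.
move=> [of_ /dense_seqP tf]; split => v; rewrite frame_sumE Re_normsqH mul1r.
  apply/lee_addgt0Pr => e e0.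
  have [w [/linear_span_uniq[s [c [us wE]]] we]] := tf v e e0.
  rewrite nsqBC wE nsq_sub_orthonormal// in we.
  apply: (@le_trans _ _ ((\sum_(n <- s) sqm (inner v (f n)))%:E + e%:E)%E).
    rewrite -EFinD lee_fin.
    have : 0 <= \sum_(n <- s) sqm (inner v (f n) - c n).
      by apply: sumr_ge0 => n _; exact: sqm_ge0.
    lra.
  rewrite leeD2r//; apply: esum_ge; exists [set` s]; first by split.
  by rewrite -fsbig_seq// sumEFin.
apply: ge_ereal_sup => _ [A [Afin _] <-].
rewrite fsbig_finite// sumEFin lee_fin.
have := @nsq_sub_orthonormal (finmap.enum_fset (fset_set A)) (fun n =>
  inner v (f n)) v of_ (finmap.fset_uniq _).
rewrite [X in _ = _ + X]big1 => [h|n _];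
  last by rewrite subrr /sqm/= expr0n addr0.
by rewrite -subr_ge0 -[leRHS]addr0 -h nsq_ge0.
Qed.

Lemma parseval_frame_frame : parseval_frame f -> frame f.
Proof. by move=> [l u]; exists 1, 1; split. Qed.

(** The lower bound leaves no nonzero vector orthogonal to a frame, which is
    totality by [orth0_total]. *)
Lemma frame_weak_frame : frame f -> weak_frame f.
Proof.
move=> [A [B [A0 B0 lA uB]]]; split; first by exists B.
apply: orth0_total => y yf; apply: nsq_eq0.
have := lA y; rewrite frame_sumE esum1; last first.
  by move=> n _; rewrite yf /sqm/= expr0n addr0.
rewrite Re_normsqH lee_fin pmulr_rle0// => h.
by apply/eqP; rewrite eq_le h nsq_ge0.
Qed.

Lemma bessel_fin v : bessel f -> (frame_sum f v < +oo)%E.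
Proof. by move=> [B B0 uB]; apply: le_lt_trans (uB v) (ltry _). Qed.

Lemma frame_sum_seq v : (frame_sum f v < +oo)%E -> exists M : R,
  forall s : seq S, uniq s -> \sum_(n <- s) sqm (inner v (f n)) <= M.
Proof.
rewrite frame_sumE => h; exists (fine
  (\esum_(n in [set: S]) (sqm (inner v (f n)))%:E)%E).
move=> s us; rewrite -lee_fin fineK.
  apply: esum_ge; exists [set` s]; first by split.
  by rewrite -fsbig_seq// sumEFin.
by rewrite ge0_fin_numE// esum_ge0// => n _; rewrite lee_fin sqm_ge0.
Qed.

End FrameTheory.

(** * The Hilbert space of square summable sequences *)

Section SquareSummable.
Variable R : realType.
Implicit Types (z : R[i]) (u v : nat -> R[i]^o).

(** The real part of [z1 * z2^*]. *)
Definition rprod z1 z2 : R :=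
  complex.Re z1 * complex.Re z2 + complex.Im z1 * complex.Im z2.

Definition ell2_pred : {pred nat -> R[i]^o} :=
  fun u => `[< exists M, forall n, \sum_(i < n) sqm (u i) <= M >].

Lemma ell2_predP u :
  reflect (exists M, forall n, \sum_(i < n) sqm (u i) <= M) (u \in ell2_pred).
Proof. exact: asboolP. Qed.

Lemma sqmD_le z1 z2 : sqm (z1 + z2) <= 2 * sqm z1 + 2 * sqm z2.
Proof.
case: z1 z2 => [a b] [c d]; rewrite /sqm /=.
have := sqr_ge0 (a - c); have := sqr_ge0 (b - d); lra.
Qed.

Lemma ell2_submod_closed : submod_closed ell2_pred.
Proof.
split=> [|a u v /ell2_predP[M HM] /ell2_predP[N HN]]; apply/ell2_predP.
  by exists 0 => n; rewrite big1// => i _; rewrite /sqm/= expr0n addr0.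
exists (2 * (sqm a * M) + 2 * N) => n.
apply: (@le_trans _ _ (\sum_(i < n) (2 * (sqm a * sqm (u i)) + 2 * sqm (v i)))).
  by apply: ler_sum => i _; rewrite -sqmM; exact: sqmD_le.
rewrite big_split/=; apply: lerD; rewrite -mulr_sumr ler_pM2l//.
  by rewrite -mulr_sumr; apply: ler_wpM2l; rewrite ?sqm_ge0 ?HM.
exact: HN.
Qed.

HB.instance Definition _ :=
  GRing.isSubmodClosed.Build R[i] (nat -> R[i]^o) ell2_pred ell2_submod_closed.

End SquareSummable.

Record ell2 (R : realType) := Ell2 {
  ell2_fun :> nat -> R[i]^o;
  ell2_sq : ell2_fun \in @ell2_pred R }.

HB.instance Definition _ (R : realType) := [isSub for @ell2_fun R].
HB.instance Definition _ (R : realType) := [Choice of ell2 R by <:].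
HB.instance Definition _ (R : realType) :=
  [SubChoice_isSubLmodule of ell2 R by <:].

Section Ell2.
Variable R : realType.
Implicit Types (u v w : ell2 R).

Lemma ell2P u v : (forall i, u i = v i) -> u = v.
Proof. by move=> uv; apply: val_inj; apply/funext. Qed.

Lemma ell2DE u v i : (u + v) i = u i + v i. Proof. by []. Qed.
Lemma ell2ZE (c : R[i]) u i : (c *: u) i = c * u i. Proof. by []. Qed.
Lemma ell2NE u i : (- u) i = - u i. Proof. by []. Qed.

Definition ell2_rterm u v (i : nat) : R := rprod (u i) (v i).
(** The real part of the inner product comes first, as a real series; the
    complex inner product is recovered from it in [ell2_inner]. *)
Definition ell2_rdot u v : R := limn (series (ell2_rterm u v)).

Lemma ell2_rterm_norm u v i : `|ell2_rterm u v i| <= sqm (u i) + sqm (v i).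
Proof.
rewrite /ell2_rterm /rprod /sqm; move: (u i) (v i) => [a b] [c d] /=.
rewrite ler_norml; have := sqr_ge0 (a + c); have := sqr_ge0 (b + d).
have := sqr_ge0 (a - c); have := sqr_ge0 (b - d).
have := sqr_ge0 (a); have := sqr_ge0 (b).
have := sqr_ge0 (c); have := sqr_ge0 (d).
by move=> *; apply/andP; split; lra.
Qed.

Lemma ell2_rdot_cvg u v : cvgn (series (ell2_rterm u v)).
Proof.
suff h : cvgn (series (fun i => `|ell2_rterm u v i|)) by exact: normed_cvg h.
apply: nondecreasing_is_cvgn; first exact: nondecreasing_series.
have [/ell2_predP[M HM] /ell2_predP[N HN]] := (ell2_sq u, ell2_sq v).
exists (M + N) => _ [n _ <-]; rewrite seriesEord/=.
apply: (@le_trans _ _ (\sum_(i < n) (sqm (u i) + sqm (v i)))).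
  by apply: ler_sum => i _; exact: ell2_rterm_norm.
by rewrite big_split lerD.
Qed.

Lemma ell2_rdotP u v : series (ell2_rterm u v) @ \oo --> ell2_rdot u v.
Proof. exact: ell2_rdot_cvg. Qed.

Lemma real_form_ell2_rdot : real_form ell2_rdot.
Proof.
split => [u v w|c u w|u v|u].
- apply/cvg_lim => //.
  have -> : series (ell2_rterm (u + v) w) =
    series (ell2_rterm u w) \+ series (ell2_rterm v w).
    apply/funext => n /=; rewrite !seriesEord/= -big_split;
      apply: eq_bigr => i _.
    by rewrite /ell2_rterm /rprod ell2DE ReD ImD/=; ring.
  by apply: cvgD; exact: ell2_rdotP.
- apply/cvg_lim => //.
  have -> : series (ell2_rterm (c%:C%C *: u) w) =
    (fun n => c * series (ell2_rterm u w) n).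
    apply/funext => n /=; rewrite !seriesEord/= mulr_sumr;
      apply: eq_bigr => i _.
    by rewrite /ell2_rterm /rprod ell2ZE; case: (u i) => a b/=; ring.
  by apply: cvgMl_tmp; exact: ell2_rdotP.
- congr (limn _); apply/funext => n; apply: eq_bigr => i _.
  by rewrite /ell2_rterm /rprod; ring.
- apply: limr_ge; first exact: ell2_rdot_cvg.
  by apply: nearW => n; apply: sumr_ge0 => i _;
    rewrite /ell2_rterm /rprod -!expr2 addr_ge0 ?sqr_ge0.
Qed.

Lemma ell2_nsq_partial_le u n : \sum_(i < n) sqm (u i) <= ell2_rdot u u.
Proof.
have t0 i : ell2_rterm u u i =
  sqm (u i) by rewrite /ell2_rterm /rprod /sqm !expr2.
have -> : \sum_(i < n) sqm (u i) = series (ell2_rterm u u) n.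
  by rewrite seriesEord; apply: eq_bigr => i _.
apply: nondecreasing_cvgn_le; last exact: ell2_rdot_cvg.
by apply: nondecreasing_series => i _ _; rewrite t0 sqm_ge0.
Qed.

Lemma ell2_nsq_le u M : (forall n, \sum_(i < n) sqm (u i) <= M) ->
  ell2_rdot u u <= M.
Proof.
move=> h; apply: limr_le; first exact: ell2_rdot_cvg.
apply: nearW => n; rewrite seriesEord/=; apply: le_trans (h n).
by apply: ler_sum => i _; rewrite /ell2_rterm /rprod /sqm !expr2.
Qed.

Definition ell2_nsq u : R := ell2_rdot u u.

Lemma ell2_nsq_eq0 u : ell2_nsq u = 0 -> u = 0.
Proof.
move=> u0; apply: ell2P => i; apply: sqm_eq0; apply/eqP.
rewrite eq_le sqm_ge0 andbT -u0; apply: le_trans (ell2_nsq_partial_le u i.+1).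
by rewrite big_ord_recr/= lerDr sumr_ge0// => j _; exact: sqm_ge0.
Qed.

Lemma sqm_le_ell2_nsq u i : sqm (u i) <= ell2_nsq u.
Proof.
apply: le_trans (ell2_nsq_partial_le u i.+1).
by rewrite big_ord_recr/= lerDr sumr_ge0// => j _; exact: sqm_ge0.
Qed.

Lemma ell2_nsq_ge0 u : 0 <= ell2_nsq u.
Proof. by have [_ _ _] := real_form_ell2_rdot; apply. Qed.

Lemma ell2_nsqZ (c : R[i]) u : ell2_nsq (c *: u) = sqm c * ell2_nsq u.
Proof.
apply/cvg_lim => //.
have -> : series (ell2_rterm (c *: u) (c *: u)) =
  (fun n => sqm c * series (ell2_rterm u u) n).
  apply/funext => n /=; rewrite !seriesEord/= mulr_sumr; apply: eq_bigr => i _.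
  by rewrite /ell2_rterm /rprod ell2ZE /sqm; case: (u i) => a b/=;
    case: c => d e /=; ring.
by apply: cvgMl_tmp; exact: ell2_rdotP.
Qed.

Definition ell2_norm u : R[i] := (Num.sqrt (ell2_nsq u))%:C%C.

Lemma ell2_nsqD u v : ell2_nsq (u + v) =
  ell2_nsq u + ell2_nsq v + 2 * ell2_rdot u v.
Proof.
have [D _ C _] := real_form_ell2_rdot;
  rewrite /ell2_nsq D (C u) (C v) !D (C v u); ring.
Qed.

Lemma ell2_rdot_le u v : ell2_rdot u v <=
  Num.sqrt (ell2_nsq u) * Num.sqrt (ell2_nsq v).
Proof.
rewrite -sqrtrM ?ell2_nsq_ge0//; apply: le_trans (ler_norm _) _.
by rewrite -sqrtr_sqr ler_wsqrtr// (cauchy_schwarz real_form_ell2_rdot).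
Qed.

Lemma ell2_norm_triangle u v : ell2_norm (u + v) <= ell2_norm u + ell2_norm v.
Proof.
rewrite /ell2_norm -rmorphD lecR.
rewrite -(@ler_pXn2r _ 2)// ?nnegrE ?addr_ge0 ?sqrtr_ge0//.
rewrite sqr_sqrtr ?ell2_nsq_ge0// ell2_nsqD sqrrD !sqr_sqrtr ?ell2_nsq_ge0//.
have := ell2_rdot_le u v; rewrite -mulr_natl; lra.
Qed.

Lemma ell2_normZ (c : R[i]) u : ell2_norm (c *: u) = `|c| * ell2_norm u.
Proof.
by rewrite /ell2_norm ell2_nsqZ sqrtrM ?sqm_ge0// rmorphM/= normc_def.
Qed.

Lemma ell2_norm_eq0 u : ell2_norm u = 0 -> u = 0.
Proof.
move=> [/eqP]; rewrite sqrtr_eq0 => h; apply: ell2_nsq_eq0; apply/eqP.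
by rewrite eq_le h ell2_nsq_ge0.
Qed.

End Ell2.

HB.instance Definition _ (R : realType) :=
  Lmodule_isNormed.Build R[i] (ell2 R) (@ell2_norm_triangle R)
    (@ell2_normZ R) (@ell2_norm_eq0 R).

Section Ell2Complete.
Variable R : realType.
Implicit Types (u v w : ell2 R).

Lemma ell2_normE u : `|u| = ell2_norm u. Proof. by []. Qed.

Lemma ell2_norm_lt u (e : R) : 0 < e -> (`|u| < e%:C%C) = (ell2_nsq u < e ^+ 2).
Proof.
move=> e0; rewrite ell2_normE ltcR -(@ltr_pXn2r _ 2)// ?nnegrE ?sqrtr_ge0
  1?ltW//.
by rewrite sqr_sqrtr// ell2_nsq_ge0.
Qed.

(** The limit is taken coordinatewise. The rate survives in every partial sum of
    the square norm, which yields at once that the limit is square summable and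
    that it is a limit in norm. *)
Lemma ell2_fast_cauchy (x : nat -> ell2 R) :
  (forall k l, ell2_nsq (x k - x l) < (k.+1%:R^-1 + l.+1%:R^-1) ^+ 2) ->
  exists p, forall k, ell2_nsq (x k - p) <= k.+1%:R^-1 ^+ 2.
Proof.
move=> hx.
have cv (a : nat -> R) :
    (forall k l, (a k - a l) ^+ 2 < (k.+1%:R^-1 + l.+1%:R^-1) ^+ 2) -> cvgn a.
  move=> ha; apply/cauchy_cvgP/cauchyP => e e0.
  have [N HN] : exists N : nat, 2 / e < N.+1%:R.
    by exists (Num.truncn (2 / e)); exact: truncnS_gt.
  exists (a N); exists N => // n /= Nn; rewrite -ball_normE /ball_/=.
  rewrite -(@ltr_pXn2r _ 2)// ?nnegrE ?normr_ge0 1?ltW// real_normK ?num_real//.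
  apply: lt_le_trans (ha N n) _;
    rewrite ler_pXn2r// ?nnegrE ?addr_ge0 ?invr_ge0 ?(ltW e0)//.
  have h k : (N <= k)%N -> k.+1%:R^-1 <= e / 2.
    move=> Nk; rewrite -[e / 2]invrK lef_pV2 ?posrE ?invr_gt0 ?divr_gt0//.
    by rewrite invf_div (le_trans (ltW HN))// ler_nat.
  by move: (h N (leqnn _)) (h n Nn);
    move: (N.+1%:R^-1) (n.+1%:R^-1) => c1 c2 ? ?; lra.
have hc k l i : sqm (x k i - x l i) < (k.+1%:R^-1 + l.+1%:R^-1) ^+ 2.
  exact: le_lt_trans (sqm_le_ell2_nsq (x k - x l) i) (hx k l).
have reB z1 z2 : complex.Re (z1 - z2) = complex.Re z1 - complex.Re z2 :> R.
  by case: z1 z2 => [? ?] [].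
have imB z1 z2 : complex.Im (z1 - z2) = complex.Im z1 - complex.Im z2 :> R.
  by case: z1 z2 => [? ?] [].
have cre i : cvgn (fun k => complex.Re (x k i)).
  apply: cv => k l; apply: le_lt_trans (hc k l i).
  by rewrite /sqm -reB lerDl sqr_ge0.
have cim i : cvgn (fun k => complex.Im (x k i)).
  apply: cv => k l; apply: le_lt_trans (hc k l i).
  by rewrite /sqm -imB lerDr sqr_ge0.
pose q i : R[i] := (limn (fun k => complex.Re (x k i)) +i* limn (fun k =>
  complex.Im (x k i)))%C.
have sqc (c : R) (a : nat -> R) (l : R) : a @ \oo --> l ->
    (fun n => (c - a n) ^+ 2) @ \oo --> (c - l) ^+ 2.
  move=> al; have cl : (fun n => c - a n) @ \oo --> c - l.
    by apply: cvgB => //; exact: cvg_cst.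
  by rewrite expr2; under eq_fun do rewrite expr2; exact: cvgM.
have inv0 : (fun l : nat => l.+1%:R^-1 : R) @ \oo --> (0 :
  R) by exact: cvg_harmonic.
have qx k n : \sum_(i < n) sqm (x k i - q i) <= k.+1%:R^-1 ^+ 2.
  have c1 : (fun l => \sum_(i < n) sqm (x k i - x l i)) @ \oo -->
      \sum_(i < n) sqm (x k i - q i).
    apply: (cvg_big (@add_continuous R)) => i _; rewrite /sqm reB imB.
    under eq_fun do rewrite reB imB.
    by apply: cvgD; apply: sqc; [exact: cre|exact: cim].
  have c2 : (fun l : nat => (k.+1%:R^-1 + l.+1%:R^-1) ^+ 2 :
    R) @ \oo --> (k.+1%:R^-1 + 0 : R) ^+ 2.
    by rewrite expr2; under eq_fun do rewrite expr2; apply: cvgM;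
      apply: cvgD => //; exact: cvg_cst.
  rewrite -[k.+1%:R^-1]addr0; apply: (ler_cvg_to c1 c2); apply: nearW => l.
  exact: le_trans (ell2_nsq_partial_le (x k - x l) n) (ltW (hx k l)).
have qin : (fun i => x 0%N i - q i : R[i]^o) \in @ell2_pred R.
  by apply/ell2_predP; exists (1%:R^-1 ^+ 2) => n; exact: qx.
exists (x 0%N - Ell2 qin) => k; apply: ell2_nsq_le => n.
apply: le_trans (qx k n); apply: ler_sum => i _.
by rewrite !(ell2DE, ell2NE) /= subKr.
Qed.

Lemma ell2_complete (F : set_system (ell2 R)) :
  ProperFilter F -> cauchy F -> cvg F.
Proof.
move=> FF /cauchyP cF.
have inv0 k : 0 < k.+1%:R^-1 :> R by rewrite invr_gt0.
have /choice[x Hx] : forall k : nat, exists x : ell2 R,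
    F [set y | ell2_nsq (x - y) < k.+1%:R^-1 ^+ 2].
  move=> k; have [|x Fx] := cF (k.+1%:R^-1%:C)%C; first by rewrite ltcR.
  exists x; move: Fx; rewrite -ball_normE /ball_; apply: filterS => y /=.
  by rewrite ell2_norm_lt.
have [p hp] : exists p, forall k, ell2_nsq (x k - p) <= k.+1%:R^-1 ^+ 2.
  apply: ell2_fast_cauchy => k l.
  have [y [/= yk yl]] := filter_ex (filterI (Hx k) (Hx l)).
  rewrite -ell2_norm_lt ?addr_gt0// rmorphD/=.
  have -> : x k - x l = (x k - y) + (y - x l) by rewrite addrA subrK.
  apply: le_lt_trans (ler_normD _ _) _; rewrite ltrD//.
    by rewrite ell2_norm_lt.
  by rewrite distrC ell2_norm_lt.
apply/cvg_ex; exists p; apply/cvg_ballP => e e0.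
have eR : e = (complex.Re e)%:C%C by apply: ge0_real; exact: ltW.
have e0' : 0 < complex.Re e by rewrite -ltcR -eR.
have [N HN] : exists N : nat, 2 / complex.Re e < N.+1%:R.
  by exists (Num.truncn (2 / complex.Re e)); exact: truncnS_gt.
apply: filterS (Hx N) => y /= Hy; rewrite -ball_normE /ball_/=.
have e2 : 0 <= complex.Re e / 2 by rewrite divr_ge0 ?ltW.
have Ne : N.+1%:R^-1 <= complex.Re e / 2.
  rewrite -[_ / 2]invrK lef_pV2 ?posrE ?invr_gt0 ?divr_gt0//.
  by rewrite invf_div ltW.
have -> : p - y = (p - x N) + (x N - y) by rewrite addrA subrK.
apply: le_lt_trans (ler_normD _ _) _.
rewrite (_ : e = (complex.Re e / 2)%:C%C + (complex.Re e / 2)%:C%C); last first.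
  by rewrite -rmorphD/= -splitr.
rewrite ler_ltD//.
  rewrite distrC ell2_normE lecR -(@ler_pXn2r _ 2)// ?nnegrE ?sqrtr_ge0 ?e2
    ?invr_ge0//.
  by rewrite sqr_sqrtr ?ell2_nsq_ge0// (le_trans (hp N))// ler_pXn2r// ?nnegrE
    ?e2 ?invr_ge0//.
by rewrite ell2_norm_lt ?divr_gt0// (lt_le_trans Hy)// ler_pXn2r// ?nnegrE ?e2
  ?invr_ge0//.
Qed.

HB.instance Definition _ := Uniform_isComplete.Build (ell2 R) ell2_complete.

End Ell2Complete.

Section Ell2Inner.
Variable R : realType.
Implicit Types (u v w : ell2 R).

(** The imaginary part is the real part of the product with [i *: v], by
    antilinearity in the second argument. *)
Definition ell2_inner u v : R[i] :=
  (ell2_rdot u v +i* ell2_rdot u ('i%C *: v))%C.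

Lemma ell2_rdotC u v : ell2_rdot u v = ell2_rdot v u.
Proof. by have [_ _ ->] := real_form_ell2_rdot R. Qed.
Lemma ell2_rdotDl u v w : ell2_rdot (u + v) w = ell2_rdot u w + ell2_rdot v w.
Proof. by have [->] := real_form_ell2_rdot R. Qed.
Lemma ell2_rdotZl (c : R) u w : ell2_rdot (c%:C%C *: u) w = c * ell2_rdot u w.
Proof. by have [_ ->] := real_form_ell2_rdot R. Qed.

Lemma ell2_rdot_i u v : ell2_rdot ('i%C *: u) v = - ell2_rdot u ('i%C *: v).
Proof.
have iso (a b : ell2 R) : ell2_rdot ('i%C *: a) ('i%C *: b) = ell2_rdot a b.
  have := ell2_nsqD ('i%C *: a) ('i%C *: b); rewrite -scalerDr !ell2_nsqZ.
  by rewrite /sqm/= expr0n expr1n add0r !mul1r ell2_nsqD => *; lra.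
rewrite -(iso ('i%C *: u) v); have -> : 'i%C *: ('i%C *: u) = - u.
  by rewrite scalerA -expr2 sqr_i scaleN1r.
have -> : - u = (- 1 : R)%:C%C *: u by rewrite rmorphN scaleN1r.
by rewrite ell2_rdotZl mulN1r.
Qed.

Lemma ell2_innerDl u v w : ell2_inner (u + v) w =
  ell2_inner u w + ell2_inner v w.
Proof. by rewrite /ell2_inner !ell2_rdotDl. Qed.

Lemma ell2_innerC u v : ell2_inner u v = (ell2_inner v u)^*.
Proof.
by rewrite conjE /ell2_inner/= (ell2_rdotC v u) (ell2_rdotC v) ell2_rdot_i
  opprK.
Qed.

Lemma ell2_innerZl (c : R[i]) u w : ell2_inner (c *: u) w = c * ell2_inner u w.
Proof.
have cE : c *: u = (complex.Re c)%:C%C *: u + (complex.Im c)%:C%C *: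
  ('i%C *: u).
  by rewrite scalerA -scalerDl mulrC -complexE.
have ii : 'i%C *: ('i%C *: w) = (- 1 : R)%:C%C *: w.
  by rewrite scalerA -expr2 sqr_i rmorphN.
rewrite /ell2_inner cE !ell2_rdotDl !ell2_rdotZl !ell2_rdot_i ii
  [ell2_rdot u (_ *: w)]ell2_rdotC.
rewrite (ell2_rdotC u (_%:C%C *: w)) ell2_rdotZl mulN1r opprK.
rewrite (ell2_rdotC w u) (ell2_rdotC _ u); case: c {cE} => a b /=.
by apply/eqP; rewrite eq_complex/=; apply/andP; split; apply/eqP; ring.
Qed.

Lemma ell2_innerDr u v w : ell2_inner w (u + v) =
  ell2_inner w u + ell2_inner w v.
Proof. by rewrite ell2_innerC ell2_innerDl rmorphD/= -!ell2_innerC. Qed.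

Lemma ell2_innerZr (c : R[i]) u w :
  ell2_inner w (c *: u) = c^* * ell2_inner w u.
Proof. by rewrite ell2_innerC ell2_innerZl rmorphM/= -!ell2_innerC. Qed.

Lemma ell2_inner_norm u : ell2_inner u u = `|u| ^+ 2.
Proof.
have ui : ell2_rdot u ('i%C *: u) = 0.
  by have := ell2_rdot_i u u; rewrite ell2_rdotC => h; lra.
rewrite /ell2_inner ui ell2_normE /ell2_norm -rmorphXn/= sqr_sqrtr//
  ell2_nsq_ge0.
by [].
Qed.

Fact ell2_innerBl u : zmod_morphism (ell2_inner^~ u).
Proof. by move=> v w; rewrite ell2_innerDl -scaleN1r ell2_innerZl mulN1r. Qed.
Fact ell2_innerBr u : zmod_morphism (ell2_inner u).
Proof.
by move=> v w; rewrite ell2_innerDr -scaleN1r ell2_innerZr rmorphN1 mulN1r.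
Qed.
Fact ell2_innerZl_subproof u : scalable_for *%R (ell2_inner^~ u).
Proof. by move=> c v; rewrite ell2_innerZl. Qed.
Fact ell2_innerZr_subproof u : scalable_for (Num.conj \; *%R) (ell2_inner u).
Proof. by move=> c v; rewrite ell2_innerZr. Qed.
Fact ell2_inner_herm u v : ell2_inner u v =
  (-1) ^+ false * Num.conj (ell2_inner v u).
Proof. by rewrite expr0 mul1r -ell2_innerC. Qed.
Fact ell2_inner_pos u : u != 0 -> 0 < ell2_inner u u.
Proof. by move=> u0; rewrite ell2_inner_norm exprn_gt0// normr_gt0. Qed.

HB.instance Definition _ := isBilinear.Build R[i] (ell2 R) (ell2 R) R[i]
  *%R (Num.conj \; *%R) ell2_inner ell2_innerBl ell2_innerBr
  ell2_innerZl_subproof ell2_innerZr_subproof.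
HB.instance Definition _ := isHermitianSesquilinear.Build R[i] (ell2 R) false
  (@Num.conj R[i]) ell2_inner ell2_inner_herm.
HB.instance Definition _ := isDotProduct.Build R[i] (ell2 R) ell2_inner
  ell2_inner_pos.

End Ell2Inner.

Lemma sum_uniq_le (R : realDomainType) (f : nat -> R) (s : seq nat) N :
  (forall i, 0 <= f i) -> uniq s -> (forall i, i \in s -> (i < N)%N) ->
  \sum_(i <- s) f i <= \sum_(i < N) f i.
Proof.
move=> f0 us sN; rewrite -(big_mkord xpredT) [leRHS](bigID (mem s))/=.
rewrite -[X in _ <= X + _]big_filter.
rewrite (_ : \sum_(i <- [seq i <- _ | _]) _ = \sum_(i <- s) f i).
  by rewrite lerDl sumr_ge0.
apply: perm_big; apply: uniq_perm; rewrite ?filter_uniq ?iota_uniq//.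
move=> i; rewrite mem_filter mem_index_iota/=.
by case: (boolP (i \in s)) => //= /sN ->.
Qed.

Section FiniteSupport.
Variable R : realType.
Implicit Types (u v w : ell2 R) (f : nat -> R[i]).

Lemma trunc_subproof f N :
  (fun i => if (i < N)%N then f i else 0 : R[i]^o) \in @ell2_pred R.
Proof.
apply/ell2_predP; exists (\sum_(i < N) sqm (f i)) => n.
rewrite (@le_trans _ _ (\sum_(i < n | (i < N)%N) sqm (f i)))//.
  rewrite [leRHS]big_mkcond/=; apply: ler_sum => i _.
  by case: ifP => // _; rewrite /sqm/= expr0n addr0.
rewrite -(big_mkord (fun i => i < N)%N (fun i => sqm (f i))) -big_filter;
  apply: sum_uniq_le => [i||i].
- exact: sqm_ge0.
- by rewrite filter_uniq ?iota_uniq.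
- by rewrite mem_filter => /andP[].
Qed.

Definition trunc f N : ell2 R := Ell2 (trunc_subproof f N).

Lemma truncE f N i : trunc f N i = if (i < N)%N then f i else 0.
Proof. by []. Qed.

Lemma ell2_rdot_trunc u f N :
  ell2_rdot u (trunc f N) = \sum_(i < N) rprod (u i) (f i).
Proof.
apply/cvg_lim => //; apply: cvg_near_cst; exists N => // n /= Nn.
rewrite seriesEord/= -(big_mkord xpredT (fun i => ell2_rterm u (trunc f N) i)).
rewrite (@big_cat_nat _ _ _ N)//= [X in _ + X]big1_seq ?addr0.
  rewrite big_mkord; apply: eq_bigr => i _.
  by rewrite /ell2_rterm truncE ltn_ord.
move=> i /andP[_]; rewrite mem_index_iota => /andP[Ni _].
by rewrite /ell2_rterm truncE ltnNge Ni /rprod/= !mulr0 addr0.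
Qed.

Lemma ell2_nsq_trunc f N : ell2_nsq (trunc f N) = \sum_(i < N) sqm (f i).
Proof.
rewrite /ell2_nsq ell2_rdot_trunc; apply: eq_bigr => i _.
by rewrite truncE ltn_ord /rprod /sqm !expr2.
Qed.

Definition delta j : ell2 R := trunc (fun i => (i == j)%:R) j.+1.

Lemma deltaE j i : delta j i = (i == j)%:R.
Proof.
by rewrite truncE ltnS; case: eqP => [->|_]; [rewrite leqnn|rewrite if_same].
Qed.

Lemma ell2_inner_delta u j : ell2_inner u (delta j) = u j.
Proof.
have rd v : ell2_rdot v (delta j) = complex.Re (v j).
  rewrite ell2_rdot_trunc big_ord_recr/= eqxx big1 ?add0r.
    by rewrite /rprod/= mulr1 mulr0 addr0.
  by move=> i _; rewrite ltn_eqF ?ltn_ord//= /rprod/= !mulr0 addr0.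
apply/eqP; rewrite eq_complex/= rd eqxx/=.
by rewrite -[ell2_rdot u _]opprK -ell2_rdot_i rd ell2ZE; case: (u j) => a b/=;
  rewrite mul0r sub0r mul1r opprK.
Qed.

(** Replacing the first [N] coordinates by [f] and the others by [0] costs the
    errors on the former plus the tail, and the tail is what the [N]-th partial
    sum leaves out of the square norm. *)
Lemma ell2_nsq_sub_trunc u f N :
  ell2_nsq (u - trunc f N) <= \sum_(i < N) sqm (u i - f i) +
    (ell2_nsq u - \sum_(i < N) sqm (u i)).
Proof.
apply: ell2_nsq_le => n; set g := fun i => sqm ((u - trunc f N) i).
apply: (@le_trans _ _ (\sum_(i < N + n) g i)).
  rewrite addnC big_split_ord/= lerDl sumr_ge0// => i _; exact: sqm_ge0.
rewrite big_split_ord/= lerD//.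
  apply: ler_sum => i _; rewrite /g ell2DE ell2NE truncE/=.
  by rewrite (ltn_ord i).
rewrite lerBrDl; apply: le_trans (ell2_nsq_partial_le u (N + n));
  rewrite big_split_ord/=.
rewrite lerD//; apply: ler_sum => i _; rewrite /g ell2DE ell2NE truncE/=.
by rewrite ltnNge leq_addr subr0.
Qed.

Lemma ell2_nsq_partial_gt u (e : R) : 0 < e ->
  exists N, ell2_nsq u - e < \sum_(i < N) sqm (u i).
Proof.
move=> e0; apply: contrapT => /forallNP h.
have : ell2_nsq u <= ell2_nsq u - e.
  by apply: ell2_nsq_le => n; rewrite leNgt; apply/negP; exact: h.
by rewrite lerBrDl gerDr leNgt e0.
Qed.

Definition ratC (q : rat * rat) : R[i] := (ratr q.1 +i* ratr q.2)%C.

Lemma ratC_dense z (e : R) : 0 < e -> exists q, sqm (z - ratC q) < e.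
Proof.
move=> e0; pose d := Num.min 1 (e / 4).
have d0 : 0 < d by rewrite lt_min ltr01 divr_gt0.
have ap (x : R) : exists q : rat, (x - ratr q) ^+ 2 < e / 2.
  have [q] := @rat_in_itvoo R (x - d) (x + d) ltac:(lra).
  rewrite in_itv/= => /andP[h1 h2]; exists q.
  have d1 : d <= 1 by rewrite ge_min lexx.
  have d2 : d <= e / 4 by rewrite ge_min lexx orbT.
  nra.
have [[a ha] [b hb]] := (ap (complex.Re z), ap (complex.Im z)).
exists (a, b); rewrite /sqm; case: z ha hb => x y /= ha hb.
lra.
Qed.

Definition rat_vec (s : seq (rat * rat)) : ell2 R :=
  trunc (fun i => ratC (nth (0, 0) s i)) (size s).

(** Finitely supported vectors with rational coordinates: half of the error goes
    to the tail, the other half to the coordinates that are kept. *)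
Lemma ell2_separable : exists D : set (ell2 R), countable D /\ dense D.
Proof.
exists (range rat_vec); split;
  first exact: card_le_trans (card_image_le _ _) (countableP _).
move=> O [y Oy] oO.
have /nbhs_ballP[d d0 dO] : nbhs y O by exact: open_nbhs_nbhs.
have dR : d = (complex.Re d)%:C%C by apply: ge0_real; exact: ltW.
have d0' : 0 < complex.Re d by rewrite -ltcR -dR.
set e := complex.Re d ^+ 2; have e0 : 0 < e by exact: exprn_gt0.
have [N HN] := ell2_nsq_partial_gt y (divr_gt0 e0 (ltr0Sn _ 1)).
have h0 : 0 < e / (2 * N.+1%:R) by rewrite divr_gt0.
have [q hq] := choice (fun i => ratC_dense (y i) h0).
exists (rat_vec (mkseq q N)); split; last by exists (mkseq q N).
apply: dO; rewrite -ball_normE /ball_/= dR ell2_norm_lt// -/e.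
rewrite /rat_vec size_mkseq; apply: le_lt_trans (ell2_nsq_sub_trunc _ _ _) _.
have : \sum_(i < N) sqm (y i - ratC (nth (0, 0) (mkseq q N) i)) <= e / 2.
  apply: (@le_trans _ _ (\sum_(i < N) e / (2 * N.+1%:R))).
    by apply: ler_sum => i _; rewrite nth_mkseq// ltW.
  rewrite sumr_const card_ord -[_ *+ N]mulr_natr.
  rewrite -[leRHS]mulr1 invfM mulrA -mulrA ler_wpM2l ?divr_ge0 ?(ltW e0)//.
  by rewrite mulrC ler_pdivrMr// mul1r ler_nat.
lra.
Qed.

End FiniteSupport.

Definition ell2H (R : realType) : hilbertSpace R :=
  @HilbertSpace R (ell2 R) (@ell2_inner R) (@ell2_inner_norm R)
    (@ell2_separable R).

(** * Unitary representations and the regular representation *)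

Section UnitaryRep.
Variables (R : realType) (G : groupType) (H : hilbertSpace R).
Variable pi : unitary_rep G H.

Lemma rep_inner g u v : inner (pi g u) (pi g v) = inner u v.
Proof. by case: (rep_unitary pi g). Qed.

Lemma nsq_rep g v : nsq (pi g v) = nsq v.
Proof. by rewrite /nsq /rdot rep_inner. Qed.

Lemma rep1 v : pi 1%g v = v.
Proof.
apply/eqP; rewrite -subr_eq0; apply/eqP/nsq_eq0.
by rewrite -(nsq_rep 1%g) linearB/= -repM mulg1 subrr /nsq /rdot linear0l.
Qed.

Lemma repVK g v : pi g (pi g^-1%g v) = v.
Proof. by rewrite -repM mulgV rep1. Qed.

Lemma inner_rep g u v : inner (pi g u) v = inner u (pi g^-1%g v).
Proof. by rewrite -{1}(repVK g v) rep_inner. Qed.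

Lemma rdot_rep g u v : rdot (pi g u) v = rdot u (pi g^-1%g v).
Proof. by rewrite /rdot inner_rep. Qed.

Lemma nsq_repV g v : nsq (pi g^-1%g v - v) = nsq (pi g v - v).
Proof. by rewrite -(nsq_rep g) linearB/= repVK nsqBC. Qed.

(** Weak containment of the trivial representation without nets: a finite list
    of group elements and a bound stand for the index of the net. *)
Definition almost_invariant := forall (F : seq G) (e : R), 0 < e ->
  exists v, nsq v = 1 /\ \sum_(g <- F) nsq (pi g v - v) < e.

Lemma weakly_contained_almost_invariant :
  trivial_weakly_contained pi -> almost_invariant.
Proof.
move=> [I [le [v [[[i0] lexx ltr le2] v1 vg]]]] F e e0.
have FF : Filter (net_filter le).
  apply: filter_from_filter; first by exists i0.
  move=> i j _ _; have [k [ik jk]] := le2 i j; exists k => // l /= kl.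
  by split; [exact: ltr ik kl|exact: ltr jk kl].
have small g (d : R) : 0 < d -> exists i, forall j, le i j ->
  nsq (pi g (v j) - v j) < d.
  move=> d0; have s0 : 0 < Num.sqrt d by rewrite sqrtr_gt0.
  have s0C : 0 < (Num.sqrt d)%:C%C :> R[i] by rewrite ltcR.
  have /cvgrPdist_lt/(_ _ s0C)[i _ Hi] := vg g.
  exists i => j ij; have := Hi j ij => /=.
  by rewrite sub0r normrN normr_id nsq_lt// sqr_sqrtr// ltW.
suff [i Hi] : exists i, forall j, le i j ->
  \sum_(g <- F) nsq (pi g (v j) - v j) < e.
  exists (v i); split; last exact: Hi.
  by apply: complexI; rewrite -normE v1 expr1n.
elim: F e e0 => [|g F IH] e e0; first by exists i0 => j _; rewrite big_nil.
have e2 : 0 < e / 2 by rewrite divr_gt0.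
have [[i Hi] [j Hj]] := (IH _ e2, small g _ e2).
have [k [ik jk]] := le2 i j; exists k => l kl; rewrite big_cons.
have := Hi l (ltr _ _ _ ik kl); have := Hj l (ltr _ _ _ jk kl); lra.
Qed.

(** An enumeration of the group turns finite lists into initial segments, so
    that a sequence of vectors is enough. *)
Lemma almost_invariant_weakly_contained (e : nat -> G) (e' : G -> nat) :
  cancel e' e -> almost_invariant -> trivial_weakly_contained pi.
Proof.
move=> e'K ai.
have n0 (n : nat) : 0 < n.+1%:R^-1 :> R by rewrite invr_gt0.
have [v Hv] := choice (fun n => ai [seq e k | k <- iota 0 n] _ (n0 n)).
exists nat, (fun m n => (m <= n)%N), v; split.
- split; [by split; exact: 0%N|exact: leqnn|by move=> ? ? ?; exact: leq_trans|].
  by move=> i j; exists (maxn i j); rewrite leq_maxl leq_maxr.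
- move=> i; have [vi _] := Hv i.
  apply/eqP; rewrite -(@eqrXn2 _ 2)// ?normr_ge0// normE vi expr1n.
  by [].
move=> g.
have FF : Filter (net_filter (fun m n => (m <= n)%N)).
  apply: filter_from_filter; first by exists 0%N.
  move=> i j _ _; exists (maxn i j) => // l /=.
  by rewrite geq_max => /andP[].
apply/cvgrPdist_lt => d d0.
have dR : d = (complex.Re d)%:C%C by apply: ge0_real; exact: ltW.
have d0' : 0 < complex.Re d by rewrite -ltcR -dR.
have d2 : 0 < complex.Re d ^+ 2 by rewrite exprn_gt0.
have [N HN] : exists N : nat, (complex.Re d ^+ 2)^-1 < N.+1%:R.
  by exists (Num.truncn (complex.Re d ^+ 2)^-1); exact: truncnS_gt.
exists (maxn N (e' g).+1) => // n /=; rewrite geq_max => /andP[Nn gn].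
rewrite sub0r normrN normr_id dR nsq_lt//.
have [_] := Hv n; rewrite big_map => h.
have gs : e' g \in iota 0 n by rewrite mem_iota.
apply: (@le_lt_trans _ _ n.+1%:R^-1); last first.
  rewrite -[ltRHS]invrK ltf_pV2 ?posrE ?invr_gt0//.
  by rewrite (lt_le_trans HN)// ler_nat.
apply: le_trans (ltW h); rewrite (big_rem _ gs)/= e'K lerDl.
by apply: sumr_ge0 => i _; exact: nsq_ge0.
Qed.

End UnitaryRep.

Lemma nsq_ell2 (R : realType) (u : ell2H R) : nsq u = ell2_nsq (u : ell2 R).
Proof. by []. Qed.

Section Regular.
Variables (R : realType) (G : groupType) (e : nat -> G) (e' : G -> nat).
Hypotheses (eK : cancel e e') (e'K : cancel e' e).
Implicit Types (u v : ell2 R).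

Lemma ell2_nsq_comp_le (t : nat -> nat) : injective t -> forall u n,
  \sum_(i < n) sqm (u (t i)) <= ell2_nsq u.
Proof.
move=> tinj u n; rewrite -(big_mkord xpredT (fun i => sqm (u (t i)))).
rewrite -(big_map t xpredT (fun i => sqm (u i))).
apply: le_trans (ell2_nsq_partial_le u (\max_(i < n) t i).+1).
apply: sum_uniq_le => [i||i].
- exact: sqm_ge0.
- by rewrite map_inj_uniq// iota_uniq.
move=> /mapP[k]; rewrite mem_index_iota => /= kn ->.
by rewrite ltnS (leq_bigmax (Ordinal kn)).
Qed.

(** Left multiplication by the inverse of [g], read on indices: composing with it
    is the left translation of functions by [g]. *)
Definition lmulV_index (g : G) (i : nat) : nat := e' (g^-1 * e i)%g.

Lemma lmulV_index_inj g : injective (lmulV_index g).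
Proof.
by move=> i j /(can_inj e'K)/mulgI/(can_inj eK).
Qed.

Lemma translate_subproof g u : (fun i => u (lmulV_index g i)) \in @ell2_pred R.
Proof.
by apply/ell2_predP; exists (ell2_nsq u) => n; apply: ell2_nsq_comp_le;
  exact: lmulV_index_inj.
Qed.

Definition translate (g : G) u : ell2 R := Ell2 (translate_subproof g u).

Lemma translateE g u i : translate g u i = u (lmulV_index g i).
Proof. by []. Qed.

Fact translate_linear g : linear (translate g).
Proof. by move=> a u v; apply: ell2P. Qed.

HB.instance Definition _ g :=
  GRing.isLinear.Build R[i] (ell2 R) (ell2 R) *:%R (translate g)
    (translate_linear g).

Lemma translateM g h u : translate (g * h)%g u = translate g (translate h u).
Proof.
apply: ell2P => i; rewrite !translateE /lmulV_index e'K.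
by rewrite invgM mulgA.
Qed.

Lemma translate1 u : translate 1%g u = u.
Proof. by apply: ell2P => i; rewrite translateE /lmulV_index invg1 mul1g eK.
  Qed.

(** Each translation does not increase the norm, and neither does its inverse. *)
Lemma ell2_nsq_translate g u : ell2_nsq (translate g u) = ell2_nsq u.
Proof.
have le h v : ell2_nsq (translate h v) <= ell2_nsq v.
  by apply: ell2_nsq_le => n; exact:
    (ell2_nsq_comp_le (@lmulV_index_inj h) v n).
apply/eqP; rewrite eq_le le/=.
by rewrite -[in leLHS](translate1 u) -(mulVg g) translateM le.
Qed.

Lemma ell2_rdot_translate g u v :
  ell2_rdot (translate g u) (translate g v) = ell2_rdot u v.
Proof.
have := ell2_nsqD (translate g u) (translate g v).
by rewrite -linearD !ell2_nsq_translate ell2_nsqD => h; lra.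
Qed.

Lemma translate_unitary g :
  @unitary_operator R (ell2H R) (translate g : {linear ell2 R -> ell2 R}).
Proof.
split=> [u v|w]; last first.
  exists (translate g^-1%g w); have := translateM g g^-1%g w.
  by rewrite mulgV translate1 => h; exact: esym h.
change (ell2_inner (translate g u) (translate g v) = ell2_inner u v).
by rewrite /ell2_inner -linearZ/= !ell2_rdot_translate.
Qed.

Definition regular : unitary_rep G (ell2H R) :=
  @UnitaryRep R G (ell2H R) (fun g => translate g : {linear ell2 R -> ell2 R})
    translate_unitary translateM.

Lemma regularE g (u : ell2 R) : regular g u = translate g u. Proof. by []. Qed.

Lemma translate_delta g h : translate g (delta R (e' h)) =
  delta R (e' (g * h)%g).
Proof.
apply: ell2P => i; rewrite translateE !deltaE /lmulV_index (can_eq e'K).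
congr (_ %:R); congr nat_of_bool.
by rewrite -(can_eq eK) e'K; apply/eqP/eqP => [<-|->]; rewrite ?mulVKg ?mulKg.
Qed.

Lemma regular_onb : onb_vector regular (delta R (e' 1%g) : ell2H R).
Proof.
have oE g : orbit_family regular (delta R (e' 1%g) :
  ell2H R) g = delta R (e' g).
  by rewrite /orbit_family regularE translate_delta mulg1.
split=> [m n|].
  rewrite !oE; change (ell2_inner (delta R (e' m)) (delta R (e' n)) =
    (m == n)%:R).
  by rewrite ell2_inner_delta deltaE (can_eq e'K) eq_sym.
apply: orth0_total => y hy; apply: (@ell2P R) => i.
have := hy (e i); rewrite oE eK.
by change (ell2_inner y (delta R i) = 0 -> (y : ell2 R) i = 0);
  rewrite ell2_inner_delta.
Qed.

End Regular.

(** * Spectral gaps and their transfer between representations *)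

Lemma bernoulli_ge (R : realDomainType) (s : R) n :
  0 <= s -> 1 + s *+ n <= (1 + s) ^+ n.
Proof.
move=> s0; elim: n => [|n IH]; first by rewrite mulr0n addr0 expr0.
rewrite exprS mulrS; have : 0 <= s *+ n by rewrite mulrn_wge0.
by nra.
Qed.

(** The ratios of a log-convex sequence increase, so that the first one is at
    most the exponential growth rate of the sequence. *)
Lemma log_convex_ratio (R : realType) (a : nat -> R) (C rho : R) :
  (forall n, 0 <= a n) -> (forall n, a n.+1 ^+ 2 <= a n * a n.+2) ->
  0 < rho -> (forall n, a n <= C * rho ^+ n) -> a 1%N <= rho * a 0%N.
Proof.
move=> a0 ac r0 aC; rewrite leNgt; apply/negP => h.
have a1p : 0 < a 1%N by apply: le_lt_trans h; rewrite mulr_ge0 // ltW.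
have a0p : 0 < a 0%N.
  rewrite lt_def a0 andbT; apply/eqP => z; have := ac 0%N.
  by rewrite z mul0r leNgt exprn_gt0.
set t := a 1%N / a 0%N.
have tr : rho < t by rewrite ltr_pdivlMr.
have t0 : 0 < t by apply: lt_trans tr.
have grow n : 0 < a n /\ t * a n <= a n.+1.
  elim: n => [|n [IH1 IH2]]; first by rewrite divfK ?gt_eqF.
  have p1 : 0 < a n.+1 by apply: lt_le_trans IH2; rewrite mulr_gt0.
  split => //; rewrite -(ler_pM2l IH1); apply: le_trans (ac n).
  by rewrite mulrCA mulrA expr2 ler_pM2r.
have ge n : t ^+ n * a 0%N <= a n.
  elim: n => [|n IH]; first by rewrite mul1r.
  apply: le_trans (proj2 (grow n)).
  by rewrite exprS -mulrA ler_pM2l.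
pose s := t / rho - 1.
have s0 : 0 < s by rewrite subr_gt0 ltr_pdivlMr// mul1r.
have bd n : s *+ n <= C / a 0%N.
  have := le_trans (ge n) (aC n); rewrite -ler_pdivlMr// => h1.
  have : (1 + s) ^+ n <= C / a 0%N.
    rewrite /s addrC subrK expr_div_n ler_pdivrMr ?exprn_gt0//.
    by rewrite mulrAC.
  by have := bernoulli_ge n (ltW s0); lra.
have := bd (Num.truncn (C / a 0%N / s)).+1.
by rewrite -mulr_natr mulrC -ler_pdivlMr// leNgt truncnS_gt.
Qed.

Section Displacement.
Variables (R : realType) (G : groupType) (H : hilbertSpace R).
Variables (pi : unitary_rep G H) (F : seq G).
Implicit Types (u v : H).

Definition displacement v : R := \sum_(g <- F) nsq (pi g v - v).

(** A unitary displaces [v] by at most [4 * nsq v] in square norm, so that this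
    constant makes [averaging] positive; the successor only serves the empty
    list. *)
Definition kappa : R := (4 * (size F).+1%:R)^-1.

(** One minus a multiple of the Laplacian of [F]: a positive contraction whose
    distance to [1] measures the displacement. *)
Definition averaging v : H :=
  v - kappa%:C%C *: \sum_(g <- F) (v + v - pi g v - pi g^-1%g v).

Lemma kappa_gt0 : 0 < kappa.
Proof. by rewrite invr_gt0 mulr_gt0. Qed.

Lemma averagingD u v : averaging (u + v) = averaging u + averaging v.
Proof.
rewrite /averaging.
have -> : \sum_(g <- F) (u + v + (u + v) - pi g (u + v) - pi g^-1%g (u + v)) =
   \sum_(g <- F) (u + u - pi g u - pi g^-1%g u) +
   \sum_(g <- F) (v + v - pi g v - pi g^-1%g v).
  rewrite -big_split/=; apply: eq_bigr => g _;
    rewrite !(linearD (pi _))/= !opprD (addrACA u v u v).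
  by rewrite (addrACA (u + u)) (addrACA (u + u - _)).
by rewrite scalerDr opprD addrACA.
Qed.

Lemma nsq_displ g v : rdot (v + v - pi g v - pi g^-1%g v) v = nsq (pi g v - v).
Proof.
rewrite !(rdotDl, rdotNl) nsqB nsq_rep -/(nsq v).
by rewrite [rdot (pi g v) v]rdot_rep [rdot v _]rdotC; lra.
Qed.

Lemma rdot_sumr u (X : G -> H) :
  rdot u (\sum_(g <- F) X g) = \sum_(g <- F) rdot u (X g).
Proof.
elim: F => [|g s IH]; last by rewrite !big_cons rdotDr IH.
by rewrite !big_nil /rdot linear0r.
Qed.

Lemma rdot_suml u (X : G -> H) :
  rdot (\sum_(g <- F) X g) u = \sum_(g <- F) rdot (X g) u.
Proof. by rewrite rdotC rdot_sumr; apply: eq_bigr => g _; rewrite rdotC. Qed.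

Lemma rdotZl (c : R) u v : rdot (c%:C%C *: u) v = c * rdot u v.
Proof. by have [_ ->] := real_form_rdot H. Qed.

Lemma averaging_self_adjoint u v : rdot (averaging u) v = rdot u (averaging v).
Proof.
rewrite /averaging rdotDl rdotDr rdotNl rdotNr [rdot u (_ *: _)]rdotC !rdotZl.
rewrite !rdot_suml; congr (_ - _ * _); apply: eq_bigr => g _.
rewrite !(rdotDl, rdotNl) !rdot_rep invgK (rdotC v u).
by rewrite (rdotC v (pi g _)) (rdotC v (pi g^-1%g u)) !rdot_rep invgK; lra.
Qed.

Lemma rdot_averaging v : rdot (averaging v) v = nsq v - kappa * displacement v.
Proof.
rewrite /averaging rdotDl rdotNl rdotZl rdot_suml; congr (_ - _ * _).
by apply: eq_bigr => g _; exact: nsq_displ.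
Qed.

Lemma displacement_le v : displacement v <= 4 * (size F)%:R * nsq v.
Proof.
rewrite /displacement; elim: F => [|g s IH].
  by rewrite big_nil mulr0 mul0r.
rewrite big_cons/= -natr1.
have := nsqD_le (pi g v) (- v); rewrite nsqN nsq_rep; lra.
Qed.

Lemma averaging_pos v : 0 <= rdot (averaging v) v.
Proof.
rewrite rdot_averaging subr_ge0 ler_pdivrMl ?mulr_gt0//.
apply: le_trans (displacement_le v) _.
by rewrite ler_wpM2r ?nsq_ge0// ler_pM2l// ler_nat.
Qed.

Lemma real_form_averaging : real_form (fun u v => rdot (averaging u) v).
Proof.
split=> [u v w|c u w|u v|u].
- by rewrite averagingD rdotDl.
- by rewrite averaging_self_adjoint rdotZl -averaging_self_adjoint.
- by rewrite averaging_self_adjoint rdotC.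
- exact: averaging_pos.
Qed.

(** A gap bounds the quadratic form of the averaging operator, which is
    positive; its norm obeys the same bound, by the Cauchy-Schwarz inequality
    for that form at [v] and [averaging v]. *)
Lemma averaging_contraction (e : R) :
  (forall v, e * nsq v <= displacement v) ->
  forall v, nsq (averaging v) <= (1 - kappa * e) ^+ 2 * nsq v.
Proof.
move=> gap v; set q := 1 - kappa * e.
have up u : rdot (averaging u) u <= q * nsq u.
  have := gap u; rewrite -(ler_pM2l kappa_gt0) rdot_averaging /q; lra.
have := cauchy_schwarz real_form_averaging v (averaging v).
rewrite -/(nsq (averaging v)) => cs.
have [->|nz] := eqVneq (nsq (averaging v)) 0;
  first by rewrite mulr_ge0 ?sqr_ge0 ?nsq_ge0.
have np : 0 < nsq (averaging v) by rewrite lt_def nz nsq_ge0.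
have h : nsq (averaging v) ^+ 2 <= (q * nsq v) * (q * nsq (averaging v)).
  by apply: le_trans cs _; rewrite ler_pM ?averaging_pos.
rewrite -(ler_pM2r np) -expr2; apply: le_trans h _.
by rewrite le_eqVlt; apply/orP; left; apply/eqP; ring.
Qed.

Lemma averaging_log_convex v n :
  nsq (iter n.+1 averaging v) ^+ 2 <=
  nsq (iter n averaging v) * nsq (iter n.+2 averaging v).
Proof.
rewrite {1}/nsq /= averaging_self_adjoint; exact: rdot_le.
Qed.

End Displacement.

(** [Rel] stands for the graph of an equivariant contraction from [K] to [H] with
    dense range; a relation spares the choice of its values. *)
Section Transfer.
Variables (R : realType) (G : groupType) (H K : hilbertSpace R).
Variables (pi : unitary_rep G H) (sg : unitary_rep G K) (Rel : H -> K -> Prop).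
Hypotheses (RelD : forall x y c d, Rel x c -> Rel y d -> Rel (x + y) (c + d))
  (RelZ : forall (a : R[i]) x c, Rel x c -> Rel (a *: x) (a *: c))
  (RelG : forall g x c, Rel x c -> Rel (pi g x) (sg g c))
  (Rel_le : forall x c, Rel x c -> nsq x <= nsq c)
  (Rel_dense : dense [set x | exists c, Rel x c]).

Lemma Rel_averaging F x c : Rel x c ->
  Rel (averaging pi F x) (averaging sg F c).
Proof.
move=> xc; have RelN y d : Rel y d -> Rel (- y) (- d).
  by rewrite -(scaleN1r y) -(scaleN1r d); exact: RelZ.
apply: RelD => //; apply: (RelN _ _); apply: RelZ.
elim: F => [|g F IH].
  by rewrite !big_nil -(scale0r x) -(scale0r c); exact: RelZ.
rewrite !big_cons; apply: RelD => //.
exact: (RelD (RelD (RelD xc xc) (RelN _ _ (RelG g xc)))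
  (RelN _ _ (RelG g^-1%g xc))).
Qed.

(** The relation sends iterates of the averaging operator on [c] to iterates on
    [x], hence the latter decay at the rate of the gap, up to a constant that
    depends on [c]. Log-convexity removes the constant. *)
Lemma displacement_transfer F (e : R) : 0 < e -> e <= 1 ->
  (forall c, e * nsq c <= displacement sg F c) ->
  forall x c, Rel x c -> e * nsq x <= displacement pi F x.
Proof.
move=> e0 e1 gap x c xc; set q := 1 - kappa R F * e.
have q0 : 0 < q.
  rewrite subr_gt0; apply: (@le_lt_trans _ _ (kappa R F)).
    by rewrite ler_piMr ?(ltW (kappa_gt0 R F)).
  rewrite invf_lt1 ?mulr_gt0//; apply: (@lt_le_trans _ _ 4);
    first by rewrite ltr1n.
  by rewrite ler_peMr// ler1n.
have itR n : Rel (iter n (averaging pi F) x) (iter n (averaging sg F) c).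
  by elim: n => //= n; exact: Rel_averaging.
have itle n : nsq (iter n (averaging sg F) c) <= nsq c * (q ^+ 2) ^+ n.
  elim: n => [|n IH] /=; first by rewrite expr0 mulr1.
  apply: le_trans (averaging_contraction gap _) _.
  by rewrite [_ ^+ n.+1]exprS mulrCA ler_pM2l// exprn_gt0.
have h1 : nsq (averaging pi F x) <= q ^+ 2 * nsq x.
  apply: (@log_convex_ratio _ (fun n =>
    nsq (iter n (averaging pi F) x)) (nsq c)).
  - by move=> n; exact: nsq_ge0.
  - by move=> n; exact: averaging_log_convex.
  - exact: exprn_gt0.
  - by move=> n; exact: le_trans (Rel_le (itR n)) (itle n).
have h2 : rdot (averaging pi F x) x <= q * nsq x.
  rewrite -(@ler_pXn2r _ 2)// ?nnegrE ?averaging_pos ?mulr_ge0 ?(ltW q0)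
    ?nsq_ge0//.
  apply: le_trans (rdot_le _ _) _; rewrite exprMn (expr2 (nsq x)) mulrA.
  by rewrite ler_wpM2r// nsq_ge0.
move: h2; rewrite rdot_averaging /q mulrBl mul1r lerD2l lerN2 -mulrA.
by rewrite ler_pM2l// kappa_gt0.
Qed.

(** Without almost invariant vectors for [sg] there is a gap, at some finite list
    [F]; it passes to a dense set of vectors for [pi], and a vector of that set
    close to an almost invariant vector of [pi] violates it. *)
Lemma almost_invariant_transfer : almost_invariant pi -> almost_invariant sg.
Proof.
move=> ai F e0 e0_gt0; apply: contrapT => /forallNP noai.
(* Gaps at most [1] keep the contraction factor positive. *)
pose e := Num.min 1 e0.
have e_gt0 : 0 < e by rewrite lt_min ltr01.
have e1 : e <= 1 by rewrite ge_min lexx.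
have gap c : e * nsq c <= displacement sg F c.
  have [c0|c0] := eqVneq (nsq c) 0.
    by rewrite c0 mulr0 sumr_ge0// => g _; exact: nsq_ge0.
  have cp : 0 < nsq c by rewrite lt_def c0 nsq_ge0.
  set t := (Num.sqrt (nsq c))^-1.
  have t2 : t ^+ 2 * nsq c = 1 by rewrite exprVn sqr_sqrtr ?nsq_ge0// mulVf.
  have sqt : sqm t%:C%C = t ^+ 2 by rewrite /sqm/= expr0n addr0.
  have := noai (t%:C%C *: c); rewrite nsqZ sqt t2 => h.
  have : e <= \sum_(g <- F) nsq (sg g (t%:C%C *: c) - t%:C%C *: c).
    by rewrite leNgt; apply/negP => h'; apply: h; split => //;
      rewrite (lt_le_trans h')// ge_min lexx orbT.
  under eq_bigr do rewrite linearZ -scalerBr nsqZ sqt.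
  rewrite -mulr_sumr -/(displacement sg F c) => h'.
  have t2p : 0 < t ^+ 2 by rewrite exprn_gt0// invr_gt0 sqrtr_gt0.
  by rewrite -(ler_pM2l t2p) mulrCA t2 mulr1.
set k : R := (size F).+1%:R.
have k1 : 1 <= k by rewrite ler1n.
have k0 : 0 < k by lra.
(* The displacement is [8 * size F]-continuous in the square distance, hence the
   factor [k] in the tolerance on the approximation of [v]. *)
set eta := e / (64 * k).
have eta0 : 0 < eta by rewrite divr_gt0// mulr_gt0.
have etak : eta * k = e / 64 by rewrite /eta; field; rewrite gt_eqF.
have eta1 : eta <= e / 64 by rewrite -etak ler_peMr// ltW.
have [v [v1 vd]] := ai F (e / 16) (divr_gt0 e_gt0 (ltr0Sn _ 15)).
have [x [[c xc] xv]] := (dense_seqP _).1 Rel_dense v eta eta0.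
have hx := displacement_transfer e_gt0 e1 gap xc.
have nx : 1 <= 2 * nsq x + 2 * eta.
  have := nsqD_le x (v - x); rewrite addrC subrK v1 nsqBC; lra.
have dx : displacement pi F x <= 2 * displacement pi F v + 8 * k * eta.
  have sD : displacement pi F x <=
    2 * displacement pi F v + 2 * displacement pi F (x - v).
    rewrite /displacement !mulr_sumr -big_split/=; apply: ler_sum => g _.
    have -> : pi g x - x = (pi g v - v) + (pi g (x - v) - (x - v)).
      by rewrite addrACA -linearD -opprD !(addrC v) subrK.
    exact: nsqD_le.
  have := displacement_le pi F (x - v).
  have : (size F)%:R * nsq (x - v) <= k * eta.
    by rewrite ler_pM ?nsq_ge0 ?(ltW xv)// ler_nat.
  lra.
have : k * eta = e / 64 by rewrite mulrC.
move: vd; rewrite -/(displacement pi F v) => vd ke.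
have : e * (1 / 2 - eta) <= e * nsq x by rewrite ler_pM2l//; lra.
have : e * eta <= e / 64 by rewrite (le_trans _ eta1)// ler_piMl// ltW.
lra.
Qed.

End Transfer.

(** * The analysis operator of a cyclic vector *)

Section AnalysisOperator.
Variables (R : realType) (G : groupType) (H : hilbertSpace R).
Variables (pi : unitary_rep G H) (w : H) (D : {pred H}).
Variables (e : nat -> G) (e' : G -> nat).
Hypotheses (eK : cancel e e') (e'K : cancel e' e).
Hypotheses (w_total : total_family (orbit_family pi w)).
Hypotheses (D_dense : dense [set` D]).
Hypotheses (D_fin : forall v, v \in D ->
  (frame_sum (orbit_family pi w) v < +oo)%E).

Local Notation lam := (regular R eK e'K).

(** The graph of the analysis operator of the orbit of [w], on the largest
    domain; the operator is closed, but it need not be bounded. *)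
Definition graph (p : H * ell2H R) :=
  forall n, (p.2 : ell2 R) n = inner p.1 (pi (e n) w).

Definition graph_form (p q : H * ell2H R) : R := rdot p.1 q.1 + rdot p.2 q.2.

Lemma real_form_graph : real_form graph_form.
Proof.
have [D1 Z1 C1 P1] := real_form_rdot H.
have [D2 Z2 C2 P2] := real_form_rdot (ell2H R).
split=> [p q s|c p s|p q|p]; rewrite /graph_form /=.
- by rewrite D1 D2 addrACA.
- by rewrite Z1 Z2 mulrDr.
- by rewrite C1 C2.
- by rewrite addr_ge0 ?P1 ?P2.
Qed.

Lemma graph_subspace : is_subspace graph.
Proof.
split=> [n|p q gp gq n|c p gp n] /=.
- by rewrite linear0l.
- by rewrite innerDl -gp -gq.
- by rewrite innerZl -gp.
Qed.

Lemma graph_dom v : v \in D -> exists z, graph (v, z).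
Proof.
move=> /D_fin/frame_sum_seq[M HM].
have vin : (fun n => inner v (pi (e n) w) : R[i]^o) \in @ell2_pred R.
  apply/ell2_predP; exists M => n.
  rewrite -(big_mkord xpredT (fun i => sqm (inner v (pi (e i) w)))).
  rewrite -(big_map e xpredT (fun g => sqm (inner v (pi g w)))).
  by apply: HM; rewrite map_inj_uniq ?iota_uniq//; exact: can_inj eK.
by exists (Ell2 vin).
Qed.

Lemma graph_equivariant g v z : graph (v, z) -> graph (pi g v, lam g z).
Proof.
move=> gvz n /=; rewrite inner_rep -repM.
by have := gvz (lmulV_index e e' g n); rewrite /= /lmulV_index e'K => <-.
Qed.

Lemma graph_closed (x : nat -> H) (z : nat -> ell2H R) v y :
  (forall n, graph (x n, z n)) -> hilbert_cvg x v -> hilbert_cvg z y ->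
    graph (v, y).
Proof.
move=> gxz xv zy i /=; apply/eqP; rewrite -subr_eq0; apply/eqP; apply: sqm_eq0.
apply/eqP; rewrite eq_le sqm_ge0 andbT; apply/ler_addgt0Pl => d d0;
  rewrite addr0.
have k0 : 0 < 4 * (nsq w + 1) by rewrite mulr_gt0// ltr_wpDl// nsq_ge0.
have [N1 H1] := xv _ (divr_gt0 d0 k0).
have [N2 H2] := zy _ (divr_gt0 d0 (ltr0Sn _ 3)).
set n := maxn N1 N2.
have := H1 n (leq_maxl _ _); rewrite ltr_pdivlMr// => h1.
have h2 := H2 n (leq_maxr _ _).
have -> : (y : ell2 R) i - inner v (pi (e i) w) =
   - ((z n : ell2 R) i - (y : ell2 R) i) + inner (x n - v) (pi (e i) w).
  rewrite innerDl -(gxz n i)/= -(scaleN1r v) innerZl mulN1r.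
  by rewrite opprB addrA subrK.
apply: le_trans (sqmD_le _ _) _.
have sN (c : R[i]) : sqm (- c) = sqm c by case: c => a b; rewrite /sqm/= !sqrrN.
rewrite sN.
have h3 : sqm ((z n : ell2 R) i - (y :
  ell2 R) i) <= nsq (z n - y) by exact: (sqm_le_ell2_nsq (z n - y : ell2 R) i).
have h4 := sqm_inner_le (x n - v) (pi (e i) w).
rewrite nsq_rep in h4; have := nsq_ge0 (x n - v); lra.
Qed.

(** Each equation of the graph compares two continuous functions, so the graph is
    closed, hence complete for its own norm. *)
Lemma graph_riesz (phi : H * ell2H R -> R) (C : R) : 0 <= C ->
  (forall u v, graph u -> graph v -> phi (u + v) = phi u + phi v) ->
  (forall (c : R) u, graph u -> phi (c%:C%C *: u) = c * phi u) ->
  (forall u, graph u -> phi u ^+ 2 <= C * graph_form u u) ->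
  exists x y, graph (x, y) /\ forall p, graph p -> phi p = graph_form p (x, y).
Proof.
move=> C0 pD pZ pC.
have [s [gs sP sC]] := riesz_seq real_form_graph graph_subspace C0 pD pZ pC.
have [x xP] : exists x, hilbert_cvg (fun n => (s n).1) x.
  apply: hilbert_complete => d d0; have [N HN] := sC d d0.
  exists N => m n Nm Nn; apply: le_lt_trans (HN m n Nm Nn).
  by rewrite /graph_form lerDl; exact: (nsq_ge0 (s m - s n).2).
have [y yP] : exists y, hilbert_cvg (fun n => (s n).2) y.
  apply: hilbert_complete => d d0; have [N HN] := sC d d0.
  exists N => m n Nm Nn; apply: le_lt_trans (HN m n Nm Nn).
  by rewrite /graph_form lerDr; exact: (nsq_ge0 (s m - s n).1).
exists x, y; split.
  by apply: (graph_closed _ xP yP) => n; case: (s n) (gs n).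
move=> p gp; apply: (riesz_limit real_form_graph (fun n => sP n p gp)).
move=> d d0; have d2 : 0 < d / 2 by rewrite divr_gt0.
have [[N1 H1] [N2 H2]] := (xP _ d2, yP _ d2).
exists (maxn N1 N2) => n; rewrite geq_max => /andP[n1 n2].
rewrite (splitr d); exact: ltrD (H1 n n1) (H2 n n2).
Qed.

(** [x] is the image of [c] under the adjoint of the analysis operator, when its
    domain carries the graph norm: for the form of the graph, [(x, z)]
    represents [y |-> <y, c>]. When the operator [A] is bounded this is
    [x = (1 + A^* A)^-1 A^* c]. *)
Definition graph_adjoint (x : H) (c : ell2H R) := exists z, graph (x, z) /\
  forall u y, graph (u, y) -> rdot u x + rdot y z = rdot y c.

Lemma rdotZr (K : hilbertSpace R) (a : R[i]) (u v : K) :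
  rdot u (a *: v) = rdot (a^* *: u) v.
Proof. by rewrite /rdot innerZr innerZl. Qed.

Lemma graph_adjointD x y c d : graph_adjoint x c -> graph_adjoint y d ->
  graph_adjoint (x + y) (c + d).
Proof.
move=> [z [gz hz]] [t [gt ht]]; exists (z + t); split.
  by have [_ + _] := graph_subspace => /(_ _ _ gz gt).
by move=> u s gus; rewrite !rdotDr -(hz _ _ gus) -(ht _ _ gus) addrACA.
Qed.

Lemma graph_adjointZ (a : R[i]) x c : graph_adjoint x c ->
  graph_adjoint (a *: x) (a *: c).
Proof.
move=> [z [gz hz]]; have [_ _ gZ] := graph_subspace; exists (a *: z); split.
  exact: gZ a _ gz.
by move=> u s gus; rewrite !rdotZr; apply: hz; exact: gZ (a^*) _ gus.
Qed.

Lemma graph_adjoint_equivariant g x c : graph_adjoint x c ->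
  graph_adjoint (pi g x) (lam g c).
Proof.
move=> [z [gz hz]]; exists (lam g z); split; first exact: graph_equivariant.
move=> u s /(@graph_equivariant g^-1%g)/hz.
by rewrite !rdot_rep !invgK !(rdotC u) !(rdotC s) !rdot_rep.
Qed.

(** Testing [(x, z)] against itself gives [nsq x + nsq z = rdot z c], which is at
    most [nsq z / 2 + nsq c / 2]. *)
Lemma graph_adjoint_le x c : graph_adjoint x c -> nsq x <= nsq c.
Proof.
move=> [z [gz hz]]; have := hz _ _ gz.
rewrite -/(nsq x) -/(nsq z); have := nsq_ge0 (z - c); rewrite nsqB.
by have := nsq_ge0 x; have := nsq_ge0 z; lra.
Qed.

Lemma graph_adjoint_total c : exists x, graph_adjoint x c.
Proof.
have [x [y [gxy hxy]]] : exists x y, graph (x, y) /\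
    forall p, graph p -> rdot p.2 c = graph_form p (x, y).
  apply: (@graph_riesz (fun p => rdot p.2 c) (nsq c)) => [|u v _ _|a u _|u _].
  - exact: nsq_ge0.
  - exact: rdotDl.
  - exact: rdotZl.
  rewrite mulrC; apply: le_trans (rdot_le _ _) _.
  by rewrite ler_wpM2r ?nsq_ge0// lerDr; exact: (nsq_ge0 u.1).
exists x, y; split => // u s gus.
by rewrite -[LHS]/(graph_form (u, s) (x, y)) -hxy.
Qed.

(** Let [y] be orthogonal to the range, and let [(k, z)] represent
    [u |-> <u, y>] on the graph. Symmetry of the form makes [z] orthogonal to
    every [c], so [z = 0]; then [k] is orthogonal to the orbit of [w], so
    [k = 0]; then [y] is orthogonal to the domain, which is dense. *)
Lemma graph_adjoint_dense : dense [set x | exists c, graph_adjoint x c].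
Proof.
apply: dense_orth0 => [|y yx].
  split=> [|u v [c uc] [d vd]|a u [c uc]].
  - have [x xc] := graph_adjoint_total 0.
    by exists (0 *: 0); rewrite -(scale0r x); exact: graph_adjointZ.
  - by exists (c + d); exact: graph_adjointD.
  - by exists (a *: c); exact: graph_adjointZ.
have [k [z [gkz hkz]]] : exists x z, graph (x, z) /\
    forall p, graph p -> rdot p.1 y = graph_form p (x, z).
  apply: (@graph_riesz (fun p => rdot p.1 y) (nsq y)) => [|u v _ _|a u _|u _].
  - exact: nsq_ge0.
  - exact: rdotDl.
  - exact: rdotZl.
  rewrite mulrC; apply: le_trans (rdot_le _ _) _.
  by rewrite ler_wpM2r ?nsq_ge0// lerDl; exact: (nsq_ge0 u.2).
have z0 : z = 0.
  have [x xz] := graph_adjoint_total z; have [t [gxt hxt]] := xz.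
  have := hxt _ _ gkz; have := hkz _ gxt.
  rewrite /graph_form /= {1}/rdot yx /=; last by exists z.
  by rewrite (rdotC x) (rdotC t) => <- /esym; exact: nsq_eq0.
have k0 : k = 0.
  apply: (total_orth0 w_total) => g.
  by have := gkz (e' g); rewrite /= z0 e'K => <-.
have Dy v : v \in D -> rdot v y = 0.
  move=> /graph_dom[s gs]; have := hkz _ gs; rewrite /graph_form/= k0 z0 => ->.
  by rewrite /rdot !linear0r addr0.
apply: nsq_eq0; apply/eqP; rewrite eq_le nsq_ge0 andbT.
apply/ler_addgt0Pl => d d0; rewrite addr0.
have [v [vD vy]] := (dense_seqP _).1 D_dense y d d0.
by move: vy; rewrite nsqB Dy//; have := nsq_ge0 v; lra.
Qed.

Lemma almost_invariant_regular : almost_invariant pi -> almost_invariant lam.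
Proof.
exact: (almost_invariant_transfer graph_adjointD graph_adjointZ
  graph_adjoint_equivariant graph_adjoint_le graph_adjoint_dense).
Qed.

End AnalysisOperator.

(** * From almost invariant vectors to an invariant mean *)

(** A cluster point exists by compactness, and an ultrafilter converges to each
    of its cluster points. *)
Lemma ultra_bounded_cvg (R : realType) (T : Type) (U : set_system T) (a :
  T -> R) (M : R) :
  UltraFilter U -> (forall n, `|a n| <= M) -> cvg (a @ U).
Proof.
move=> UU aM; have PU : ProperFilter U by exact: ultra_proper.
have aU : (a @ U) [set` `[- M, M]].
  by apply: (@filterE _ U) => n /=; rewrite in_itv/= -ler_norml.
have [p [_ pcl]] := @segment_compact R (- M) M (a @ U) _ aU.
apply/cvg_ex; exists p => B pB.
have [//|UB] := in_ultra_setVsetC (a @^-1` B) UU.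
by have [x []] := pcl (~` B) B UB pB.
Qed.

Section MeanOfVectors.
Variables (R : realType) (G : groupType) (e : nat -> G) (e' : G -> nat).
Hypotheses (eK : cancel e e') (e'K : cancel e' e).
Implicit Types (f : linfty R G) (c d : ell2 R).

Local Notation lam := (regular R eK e'K).

Lemma linfty_sqm_bound f : exists B : R, 0 <= B /\ forall x, sqm (f x) <= B.
Proof.
have /linfty_predP[M HM] := linfty_bounded f.
exists (sqm M); split => [|x]; first exact: sqm_ge0.
rewrite -lecR -!sqmE ler_pXn2r ?nnegrE ?normr_ge0//.
by rewrite (ger0_norm (le_trans (normr_ge0 _) (HM x))).
Qed.

Lemma linfty_mul_sum_le f c (B : R) n : 0 <= B -> (forall x, sqm (f x) <= B) ->
  \sum_(i < n) sqm (f (e i) * c i) <= B * ell2_nsq c.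
Proof.
move=> B0 HB; apply: le_trans (ler_wpM2l B0 (ell2_nsq_partial_le c n)).
rewrite mulr_sumr; apply: ler_sum => i _.
by rewrite sqmM ler_wpM2r ?sqm_ge0.
Qed.

Lemma linfty_mul_subproof f c :
  (fun i => f (e i) * c i : R[i]^o) \in @ell2_pred R.
Proof.
have [B [B0 HB]] := linfty_sqm_bound f; apply/ell2_predP.
by exists (B * ell2_nsq c) => n; exact: linfty_mul_sum_le.
Qed.

Definition linfty_mul f c : ell2 R := Ell2 (linfty_mul_subproof f c).

Lemma ell2_nsq_linfty_mul f c (B : R) : 0 <= B -> (forall x, sqm (f x) <= B) ->
  ell2_nsq (linfty_mul f c) <= B * ell2_nsq c.
Proof. by move=> B0 HB; apply: ell2_nsq_le => n; exact: linfty_mul_sum_le. Qed.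

(** The mean of [f] for the probability density [i |-> `|c i| ^+ 2]. *)
Definition vector_mean f c : R[i] := ell2_inner (linfty_mul f c) c.

Lemma vector_meanP (a : R[i]) f g c :
  vector_mean (a *: f + g) c = a * vector_mean f c + vector_mean g c.
Proof.
rewrite /vector_mean -ell2_innerZl -ell2_innerDl; congr ell2_inner.
by apply: ell2P => i /=; rewrite mulrDl -mulrA.
Qed.

Lemma vector_mean1 c : ell2_nsq c = 1 -> vector_mean (linfty1 R G) c = 1.
Proof.
move=> c1; rewrite /vector_mean (_ : linfty_mul _ _ = c).
  by rewrite ell2_inner_norm ell2_normE /ell2_norm c1 sqrtr1 expr1n.
by apply: ell2P => i /=; rewrite mul1r.
Qed.

Lemma vector_mean_ge0 f c : (forall x, 0 <= f x) -> 0 <= vector_mean f c.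
Proof.
move=> f0; have fR x : complex.Im (f x) = 0 by apply: ger0_Im.
have fR0 x : 0 <= complex.Re (f x) by have := f0 x; rewrite lecE => /andP[].
rewrite lecE /vector_mean /ell2_inner/=; apply/andP; split.
  apply/eqP/cvg_lim => //.
  rewrite (_ : series _ = cst 0); first exact: cvg_cst.
  apply/funext => n; rewrite seriesEord/= big1// => i _.
  rewrite /ell2_rterm (ell2ZE _ c i) /rprod/=; have := fR (e i).
  by case: (f (e i)) (c i) => [x y] [z t] /= ->; ring.
apply: limr_ge; first exact: ell2_rdot_cvg.
apply: nearW => n; rewrite seriesEord/=; apply: sumr_ge0 => i _.
rewrite /ell2_rterm /rprod/=; have := fR (e i); have := fR0 (e i).
case: (f (e i)) (c i) => [x y] [z t] /= x0 ->.
rewrite (_ : _ + _ = x * (z ^+ 2 + t ^+ 2)); last by ring.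
by rewrite mulr_ge0// addr_ge0 ?sqr_ge0.
Qed.

(** Reindexing the mean by left multiplication, that is applying the unitary
    [lam g^-1] to both factors of the inner product. *)
Lemma vector_mean_translate g f c :
  vector_mean (ltrans g f) c = vector_mean f (lam g^-1%g c).
Proof.
rewrite /vector_mean -[LHS](@rep_inner _ _ _ lam g^-1%g (linfty_mul _ c :
  ell2H R) (c : ell2H R)).
congr (ell2_inner _ _); apply: ell2P => i /=.
by rewrite /lmulV_index e'K invgK mulKg.
Qed.

Lemma vector_mean_bound f c (B : R) : 0 <= B -> (forall x, sqm (f x) <= B) ->
  ell2_nsq c = 1 -> sqm (vector_mean f c) <= B.
Proof.
move=> B0 HB c1; apply: le_trans (@sqm_inner_le _ (ell2H R) (linfty_mul f c) c)
  _.
rewrite !nsq_ell2 c1 mulr1; apply: le_trans (ell2_nsq_linfty_mul c B0 HB) _.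
by rewrite c1 mulr1.
Qed.

Lemma vector_mean_close f c d (B : R) : 0 <= B -> (forall x, sqm (f x) <= B) ->
  ell2_nsq c = 1 -> ell2_nsq d = 1 ->
  sqm (vector_mean f d - vector_mean f c) <= 4 * B * ell2_nsq (d - c).
Proof.
move=> B0 HB c1 d1.
have -> : vector_mean f d - vector_mean f c =
    ell2_inner (linfty_mul f (d - c)) d + ell2_inner (linfty_mul f c) (d - c).
  have -> : linfty_mul f (d - c) = linfty_mul f d - linfty_mul f c.
    by apply: ell2P => i /=; rewrite mulrBr.
  by rewrite linearBl linearBr /vector_mean addrA subrK.
apply: le_trans (sqmD_le _ _) _.
have h1 := @sqm_inner_le _ (ell2H R) (linfty_mul f (d - c)) d.
have h2 := @sqm_inner_le _ (ell2H R) (linfty_mul f c) (d - c : ell2 R).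
have h3 := ell2_nsq_linfty_mul (d - c) B0 HB.
have h4 := ler_wpM2r (ell2_nsq_ge0 (d - c)) (ell2_nsq_linfty_mul c B0 HB).
rewrite !nsq_ell2 d1 mulr1 in h1; rewrite c1 mulr1 in h4.
have h5 : sqm (ell2_inner (linfty_mul f (d - c)) d) <= B * ell2_nsq (d - c).
  exact: le_trans h1 h3.
have h6 : sqm (ell2_inner (linfty_mul f c) (d - c)) <= B * ell2_nsq (d - c).
  exact: le_trans h2 h4.
lra.
Qed.

(** The means of a sequence of more and more invariant vectors converge along an
    ultrafilter finer than the neighbourhoods of infinity; real and imaginary
    parts are handled apart, to stay within compact intervals. Invariance holds
    in the limit since nearby vectors give nearby means, uniformly over a
    bounded set of functions. *)
Lemma almost_invariant_amenable : almost_invariant lam -> amenable R G.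
Proof.
move=> ai.
have n0 (n : nat) : 0 < n.+1%:R^-1 :> R by rewrite invr_gt0.
have [c Hc] := choice (fun n => ai [seq e k | k <- iota 0 n] _ (n0 n)).
have c1 n : ell2_nsq (c n : ell2 R) = 1 by case: (Hc n).
have [U [UU Uoo]] := @ultraFilterLemma _ \oo _.
have PU : ProperFilter U by exact: ultra_proper.
pose m f n := vector_mean f (c n).
have bnd f : exists M : R, forall n,
    `|complex.Re (m f n)| <= M /\ `|complex.Im (m f n)| <= M.
  have [B [B0 HB]] := linfty_sqm_bound f; exists (Num.sqrt B) => n.
  have := vector_mean_bound B0 HB (c1 n); rewrite /sqm -/(m f n) => h.
  split; rewrite -[leLHS]sqrtr_sqr; apply: ler_wsqrtr; apply: le_trans h.
    by rewrite lerDl sqr_ge0.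
  by rewrite lerDr sqr_ge0.
have Re_cvg f : cvg ((fun n => complex.Re (m f n)) @ U).
  by have [M HM] := bnd f; apply: (@ultra_bounded_cvg _ _ _ _ M UU) => n;
    exact: (HM n).1.
have Im_cvg f : cvg ((fun n => complex.Im (m f n)) @ U).
  by have [M HM] := bnd f; apply: (@ultra_bounded_cvg _ _ _ _ M UU) => n;
    exact: (HM n).2.
pose phi f : R[i] := (lim ((fun n => complex.Re (m f n)) @ U) +i*
                      lim ((fun n => complex.Im (m f n)) @ U))%C.
have phiE f (z : R[i]) : (fun n => complex.Re (m f n)) @ U --> complex.Re z ->
    (fun n => complex.Im (m f n)) @ U --> complex.Im z -> phi f = z.
  move=> h1 h2; rewrite /phi.
  have -> : lim ((fun n => complex.Re (m f n)) @ U) =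
    complex.Re z by exact: cvg_lim h1.
  have -> : lim ((fun n => complex.Im (m f n)) @ U) =
    complex.Im z by exact: cvg_lim h2.
  by case: (z).
have phi_lin (a : R[i]) f g : phi (a *: f + g) = a * phi f + phi g.
  have mE n : m (a *: f + g) n = a * m f n + m g n by exact: vector_meanP.
  apply: phiE.
    have -> : complex.Re (a * phi f + phi g) =
      complex.Re a * complex.Re (phi f) - complex.Im a * complex.Im (phi f) +
      complex.Re (phi g).
      by case: a (phi f) (phi g) {mE} => [? ?] [? ?] [? ?].
    have -> : (fun n => complex.Re (m (a *: f + g) n)) =
       (fun n => complex.Re a * complex.Re (m f n) - complex.Im a * complex.Im
         (m f n) + complex.Re (m g n)).
      by apply/funext => n; rewrite mE;
        case: a (m f n) (m g n) {mE} => [? ?] [? ?] [? ?].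
    apply: cvgD; last exact: Re_cvg.
    by apply: cvgB; apply: cvgMl_tmp; [exact: Re_cvg|exact: Im_cvg].
  have -> : complex.Im (a * phi f + phi g) =
    complex.Re a * complex.Im (phi f) + complex.Im a * complex.Re (phi f) +
    complex.Im (phi g).
    by case: a (phi f) (phi g) {mE} => [? ?] [? ?] [? ?].
  have -> : (fun n => complex.Im (m (a *: f + g) n)) =
     (fun n => complex.Re a * complex.Im (m f n) + complex.Im a * complex.Re
       (m f n) + complex.Im (m g n)).
    by apply/funext => n; rewrite mE;
      case: a (m f n) (m g n) {mE} => [? ?] [? ?] [? ?].
  apply: cvgD; last exact: Im_cvg.
  by apply: cvgD; apply: cvgMl_tmp; [exact: Im_cvg|exact: Re_cvg].
pose Phi : {scalar linfty R G} := HB.pack phi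
  (GRing.isLinear.Build R[i] (linfty R G) R[i] *%R phi phi_lin).
exists Phi; split.
- move=> f f0; have mf n : 0 <= m f n by exact: vector_mean_ge0.
  have iz : lim ((fun n => complex.Im (m f n)) @ U) = 0.
    apply: cvg_lim => //; rewrite (_ : (fun _ => _) = cst 0);
      first exact: cvg_cst.
    by apply/funext => n /=; have := mf n; rewrite lecE/= => /andP[/eqP].
  rewrite lecE /= iz eqxx/=; apply: limr_ge; first exact: Re_cvg.
  by apply: nearW => n; have := mf n; rewrite lecE => /andP[].
- apply: phiE.
    rewrite (_ : (fun _ => _) = cst 1); first exact: cvg_cst.
    by apply/funext => n; rewrite /m vector_mean1.
  rewrite (_ : (fun _ => _) = cst 0); first exact: cvg_cst.
  by apply/funext => n; rewrite /m vector_mean1.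
move=> g f.
have [B [B0 HB]] := linfty_sqm_bound f.
have small : forall d : R, 0 < d -> \forall n \near U,
    sqm (m (ltrans g f) n - m f n) < d.
  move=> d d0; apply: Uoo.
  have k0 : 0 < d / (4 * B + 1) by rewrite divr_gt0// ltr_wpDl// mulr_ge0.
  have [N HN] : exists N : nat, (d / (4 * B + 1))^-1 < N.+1%:R.
    by exists (Num.truncn (d / (4 * B + 1))^-1); exact: truncnS_gt.
  exists (maxn N (e' g).+1) => // n /=; rewrite geq_max => /andP[Nn gn].
  rewrite /m vector_mean_translate.
  have cg : ell2_nsq (lam g^-1%g (c n) : ell2 R) = 1.
    by rewrite -nsq_ell2 nsq_rep nsq_ell2.
  apply: le_lt_trans (vector_mean_close B0 HB (c1 n) cg) _.
  rewrite -nsq_ell2 nsq_repV.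
  have [_] := Hc n; rewrite big_map => h.
  have gs : e' g \in iota 0 n by rewrite mem_iota.
  have : nsq (lam g (c n) - c n) < d / (4 * B + 1).
    apply: (@le_lt_trans _ _ n.+1%:R^-1); last first.
      rewrite -[ltRHS]invrK ltf_pV2 ?posrE ?invr_gt0//.
      by rewrite (lt_le_trans HN)// ler_nat.
    apply: le_trans (ltW h); rewrite (big_rem _ gs)/= e'K lerDl.
    by apply: sumr_ge0 => i _; exact: nsq_ge0.
  rewrite ltr_pdivlMr; last by rewrite ltr_wpDl// mulr_ge0.
  by have := nsq_ge0 (lam g (c n) - c n); lra.
have near0 (a b : nat -> R) (l : R) : b @ U --> l ->
    (forall d : R, 0 < d -> \forall n \near U, (a n - b n) ^+ 2 < d) ->
      a @ U --> l.
  move=> bl ab; have -> : a = (fun n => (a n - b n) + b n).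
    by apply/funext => n; rewrite subrK.
  rewrite -[l]add0r; apply: cvgD => //.
  apply/cvgrPdist_lt => d d0; have := ab _ (exprn_gt0 2 d0).
  apply: filterS => n; rewrite sub0r normrN => h.
  by rewrite -(@ltr_pXn2r _ 2)// ?nnegrE ?(ltW d0)// real_normK ?num_real.
apply: phiE.
  apply: (near0 _ (fun n => complex.Re (m f n))); first exact: Re_cvg.
  move=> d /small; apply: filterS => n; apply: le_lt_trans.
  by rewrite /sqm; case: (m (ltrans g f) n) (m f n) => [? ?] [? ?] /=;
    rewrite lerDl sqr_ge0.
apply: (near0 _ (fun n => complex.Im (m f n))); first exact: Im_cvg.
move=> d /small; apply: filterS => n; apply: le_lt_trans.
by rewrite /sqm; case: (m (ltrans g f) n) (m f n) => [? ?] [? ?] /=;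
  rewrite lerDr sqr_ge0.
Qed.

End MeanOfVectors.

(** * Linear functionals below a sublinear one *)

Section HahnBanach.
Variables (R : realType) (V : lmodType R).
Implicit Types (p q : V -> R) (K : V -> R -> Prop).

Definition sublinear p :=
  (forall x y, p (x + y) <= p x + p y) /\ (forall t x, 0 <= t -> p (t *: x) =
    t * p x).

Definition convex_cone K :=
  [/\ K 0 0, forall x a y b, K x a -> K y b -> K (x + y) (a + b)
    & forall t x a, 0 <= t -> K x a -> K (t *: x) (t * a)].

Lemma sublinear0 p : sublinear p -> p 0 = 0.
Proof. by move=> [_ pZ]; rewrite -(scale0r 0) pZ// mul0r. Qed.

Lemma sublinear_oppr p x : sublinear p -> - p (- x) <= p x.
Proof.
move=> ps; have := sublinear0 ps; have [pD _] := ps.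
by have := pD x (- x); rewrite subrr => h h0; lra.
Qed.

(** Lowering a sublinear functional along a cone: every linear functional below
    the result is at least [a] at [x], for all [(x, a)] in the cone. *)
Lemma sublinear_lower p K : sublinear p -> convex_cone K ->
  (forall x a, K x a -> a <= p x) ->
  exists q, [/\ sublinear q, forall x, q x <= p x
    & forall x a, K x a -> q (- x) <= - a].
Proof.
move=> ps [K0 KD KZ] Kp; have [pD pZ] := ps.
pose E x := [set z | exists y a, K y a /\ z = p (x + y) - a].
have Elb x : has_inf (E x).
  split; first by exists (p (x + 0) - 0), 0, 0.
  exists (- p (- x)) => _ [y [a [Kya ->]]].
  have := pD (- x) (x + y); rewrite addKr; have := Kp _ _ Kya; lra.
pose q x := inf (E x).
have qle x y a : K y a -> q x <= p (x + y) - a.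
  by move=> Kya; apply: ge_inf; [case: (Elb x)|exists y, a].
have qge x b : (forall y a, K y a -> b <= p (x + y) - a) -> b <= q x.
  by move=> h; apply: lb_le_inf;
    [case: (Elb x)|move=> _ [y [a [Kya ->]]]; exact: h].
have qZ t x : 0 < t -> t * q x <= q (t *: x).
  move=> t0; apply: qge => y a Kya; rewrite mulrC -ler_pdivlMr//.
  have t1 : 0 <= t^-1 by rewrite invr_ge0 ltW.
  have := qle x _ _ (KZ _ _ _ t1 Kya).
  suff -> : p (x + t^-1 *: y) - t^-1 * a = (p (t *: x + y) - a) / t by [].
  have -> : x + t^-1 *: y = t^-1 *: (t *: x + y).
    by rewrite scalerDr scalerA mulVf ?gt_eqF// scale1r.
  by rewrite pZ// mulrBl; ring.
have q0 : q 0 = 0.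
  apply/eqP; rewrite eq_le; apply/andP; split.
    by have := qle 0 0 0 K0; rewrite addr0 subr0 (sublinear0 ps).
  by apply: qge => y a Kya; rewrite add0r subr_ge0; exact: Kp.
exists q; split=> [|x|x a Kxa].
- split=> [x y|t x].
    apply/ler_addgt0Pr => d d0; have d2 : 0 < d / 2 by rewrite divr_gt0.
    have [_ [u [a [Kua ->]]] hu] := inf_adherent d2 (Elb x).
    have [_ [v [b [Kvb ->]]] hv] := inf_adherent d2 (Elb y).
    have := qle (x + y) _ _ (KD _ _ _ _ Kua Kvb).
    rewrite addrACA; have := pD (x + u) (y + v).
    move: hu hv; rewrite -/(q x) -/(q y) => hu hv h1 h2; lra.
  rewrite le_eqVlt => /orP[/eqP<-|t0]; first by rewrite scale0r mul0r.
  apply/eqP; rewrite eq_le qZ// andbT.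
  have t1 : 0 < t^-1 by rewrite invr_gt0.
  have := qZ _ (t *: x) t1; rewrite scalerA mulVf ?gt_eqF// scale1r.
  by rewrite mulrC ler_pdivrMr// mulrC.
- by have := qle x 0 0 K0; rewrite addr0 subr0.
- by have := qle (- x) _ _ Kxa; rewrite addNr (sublinear0 ps) sub0r.
Qed.

(** Sublinear functionals below [p] are bounded below by [x |-> - p (- x)], so
    the pointwise infimum of a chain is finite; it is sublinear since two members
    of a chain can be replaced by the smaller one. *)
Lemma minimal_sublinear p : sublinear p -> exists q,
  [/\ sublinear q, forall x, q x <= p x
    & forall s, sublinear s -> (forall x, s x <= q x) -> s = q].
Proof.
move=> ps.
pose T := {q : V -> R | sublinear q /\ forall x, q x <= p x}.
pose le (s t : T) : bool := `[< forall x, sval t x <= sval s x >].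
have [|r s t /asboolP h1 /asboolP h2|s t /asboolP h1 /asboolP h2|A
  tA|[q [qs qp]] qmin] := @Zorn T le.
- by move=> t; apply/asboolP.
- by apply/asboolP => x; exact: le_trans (h2 x) (h1 x).
- move: s t h1 h2 => [s ps1] [t pt1] /= h1 h2.
  by apply: eq_exist; apply/funext => x; apply/eqP; rewrite eq_le h1 h2.
- have [[t0 At0]|A0] := pselect (exists t, A t); last first.
    by exists (exist _ p (conj ps (fun=> lexx _))) => s As; case: A0; exists s.
  pose E x := [set sval t x | t in A].
  have Elb x : has_inf (E x).
    split; first by exists (sval t0 x), t0.
    exists (- p (- x)) => _ [[t [ts tp]] _ <-] /=.
    by apply: le_trans (sublinear_oppr x ts); rewrite lerN2.
  pose q x := inf (E x).
  have qle x t : A t -> q x <= sval t x.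
    by move=> At; apply: ge_inf; [case: (Elb x)|exists t].
  have qs : sublinear q.
    split=> [x y|t x t_ge0].
      apply/ler_addgt0Pr => d d0; have d2 : 0 < d / 2 by rewrite divr_gt0.
      have [_ [u Au <-] hu] := inf_adherent d2 (Elb x).
      have [_ [v Av <-] hv] := inf_adherent d2 (Elb y).
      have key w : A w -> sval w x <= sval u x -> sval w y <= sval v y ->
          q (x + y) <= q x + q y + d.
        move=> Aw h1 h2; have := qle (x + y) w Aw; have [wD _] := (svalP w).1.
        have := wD x y; move: hu hv; rewrite -/(q x) -/(q y); lra.
      case: (tA u v Au Av) => /asboolP h; [exact: (key v)|exact: (key u)].
    apply/eqP; rewrite eq_le; apply/andP; split.
      have /orP[/eqP<-|t_gt0] : (0 == t) || (0 < t) by rewrite -le_eqVlt.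
        rewrite mul0r scale0r; apply: le_trans (qle 0 _ At0) _.
        by rewrite (sublinear0 (svalP t0).1).
      rewrite mulrC -ler_pdivrMr//; apply: lb_le_inf; first by case: (Elb x).
      move=> _ [w Aw <-]; rewrite ler_pdivrMr//; apply: le_trans (qle _ w Aw) _.
      by rewrite (svalP w).1.2// mulrC.
    apply: lb_le_inf; first by case: (Elb (t *: x)).
    move=> _ [w Aw <-]; rewrite (svalP w).1.2//.
    by apply: ler_wpM2l => //; exact: qle.
  have qp x : q x <= p x by apply: le_trans (qle x _ At0) _;
    exact: (svalP t0).2.
  by exists (exist _ q (conj qs qp)) => s As; apply/asboolP => x; exact: qle.
exists q; split => // s ss sq.
have sp x : s x <= p x by exact: le_trans (sq x) (qp x).
have := qmin (exist _ s (conj ss sp)); move=> /(_ ltac:(exact/asboolP)).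
by move=> [].
Qed.

(** The Hahn-Banach theorem in the form of a separation from a cone. After
    lowering [p] along the cone, a minimal sublinear functional is linear:
    lowering it along the ray of [x], with its own values there, cannot change
    it, and that says [L (- x) <= - L x]. *)
Lemma hahn_banach_cone p K : sublinear p -> convex_cone K ->
  (forall x a, K x a -> a <= p x) ->
  exists L : V -> R, [/\ forall x y, L (x + y) = L x + L y,
    forall x, L (- x) = - L x, forall x, L x <= p x
  & forall x a, K x a -> a <= L x].
Proof.
move=> ps Kc Kp; have [q [qs qp qK]] := sublinear_lower ps Kc Kp.
have [L [Ls Lq Lmin]] := minimal_sublinear qs.
have [LD LZ] := Ls.
have LN x : L (- x) = - L x.
  apply/eqP; rewrite eq_le; apply/andP; split; last first.
    by rewrite lerNl; exact: sublinear_oppr.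
  pose ray y a := exists t, [/\ 0 <= t, y = t *: x & a = t * L x].
  have [s [ss sL sr]] : exists s, [/\ sublinear s, forall x, s x <= L x
      & forall y a, ray y a -> s (- y) <= - a].
    apply: sublinear_lower => //.
      split=> [|_ _ _ _ [t [t0 -> ->]] [u [u0 -> ->]]|u _ _ u0 [t [t0 -> ->]]].
      - by exists 0; rewrite scale0r mul0r.
      - by exists (t + u); rewrite addr_ge0// scalerDl mulrDl.
      - by exists (u * t); rewrite mulr_ge0// scalerA mulrA.
    by move=> _ _ [t [t0 -> ->]]; rewrite LZ.
  have sE := Lmin s ss sL; rewrite -[X in X (- x)]sE.
  by apply: sr; exists 1; rewrite ler01 scale1r mul1r.
exists L; split=> [x y||x|x a Kxa].
- apply/eqP; rewrite eq_le LD/=.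
  by have := LD (x + y) (- y); rewrite addrK LN lerBrDr.
- exact: LN.
- exact: le_trans (Lq x) (qp x).
- by rewrite -lerN2 -LN; apply: le_trans (Lq _) (qK _ _ Kxa).
Qed.

End HahnBanach.

(** * From an invariant mean to almost invariant vectors *)

Section PolyNorm.
Variable R : realType.
Implicit Types p q : {poly R}.

(** Polynomials serve as the finitely supported real functions on the natural
    numbers, and this is their l1 norm. *)
Definition poly_norm p : R := \sum_(i < size p) `|p`_i|.

Lemma poly_normE p N : (size p <= N)%N -> poly_norm p = \sum_(i < N) `|p`_i|.
Proof.
move=> pN; rewrite /poly_norm -!(big_mkord xpredT (fun i => `|p`_i|)).
rewrite [RHS](@big_cat_nat _ _ _ (size p))//= [X in _ + X]big1_seq ?addr0// =>
  i.
by rewrite mem_index_iota => /andP[_ /andP[pi _]]; rewrite nth_default ?normr0.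
Qed.

Lemma poly_normD p q : poly_norm (p + q) <= poly_norm p + poly_norm q.
Proof.
rewrite (poly_normE (size_polyD p q)) (poly_normE (leq_maxl _ _ :
  size p <= maxn (size p) (size q))%N).
rewrite (poly_normE (leq_maxr _ _ :
  size q <= maxn (size p) (size q))%N) -big_split/=.
by apply: ler_sum => i _; rewrite coefD ler_normD.
Qed.

Lemma poly_normZ (t : R) p : 0 <= t -> poly_norm (t *: p) = t * poly_norm p.
Proof.
move=> t0; rewrite (poly_normE (size_scale_leq t p)) mulr_sumr.
by apply: eq_bigr => i _; rewrite coefZ normrM ger0_norm.
Qed.

Lemma poly_norm_ge p n : \sum_(i < n) `|p`_i| <= poly_norm p.
Proof.
rewrite (poly_normE (leq_maxl (size p) n)) -!(big_mkord xpredT (fun i =>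
  `|p`_i|)).
rewrite [leRHS](@big_cat_nat _ _ _ n)//= ?leq_maxr// lerDl sumr_ge0//.
Qed.

Lemma poly_normXn n : poly_norm ('X^n) = 1.
Proof.
rewrite /poly_norm size_polyXn big_ord_recr/= coefXn eqxx normr1 big1 ?add0r//.
by move=> i _; rewrite coefXn ltn_eqF// normr0.
Qed.

Lemma poly_norm0 : poly_norm 0 = 0.
Proof. by rewrite /poly_norm size_poly0 big_ord0. Qed.

End PolyNorm.

Section Reiter.
Variables (R : realType) (G : groupType) (e : nat -> G) (e' : G -> nat).
Hypotheses (e'K : cancel e' e).
Variables (m : nat) (g : 'I_m -> G).

Definition lmul_index (k : 'I_m) (n : nat) : nat := e' (g k * e n)%g.

Definition multi_norm (v : 'I_m -> {poly R}) : R := \sum_k poly_norm (v k).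

Lemma sublinear_multi_norm : @sublinear R ('I_m -> {poly R}) multi_norm.
Proof.
split=> [u v|t u t0]; rewrite /multi_norm.
  by rewrite -big_split/=; apply: ler_sum => k _; exact: poly_normD.
by rewrite mulr_sumr; apply: eq_bigr => k _; exact: poly_normZ.
Qed.

Definition single (k : 'I_m) (p : {poly R}) : 'I_m -> {poly R} :=
  fun k' => if k' == k then p else 0.

Lemma multi_norm_single k n : multi_norm (single k 'X^n) = 1.
Proof.
rewrite /multi_norm (bigD1 k)//= /single eqxx poly_normXn big1 ?addr0// => i ik.
by rewrite (negbTE ik) poly_norm0.
Qed.

Definition point_displacement (n : nat) : 'I_m -> {poly R} :=
  fun k => 'X^(lmul_index k n) - 'X^n.

Definition combination (s : seq (R * nat)) : 'I_m -> {poly R} :=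
  \sum_(x <- s) x.1 *: point_displacement x.2.

Definition total_mass (s : seq (R * nat)) : R := \sum_(x <- s) x.1.

Definition nonneg_weights (s : seq (R * nat)) := forall x, x \in s -> 0 <= x.1.

(** Reiter's property. If the displacements of all finitely supported densities
    were at least [eps] times their mass, a functional separating the cone of
    these displacements would have bounded coordinates [f k] such that
    [f k (g k * x) - f k x], summed over [k], is at least [eps] at each [x]; an
    invariant mean gives this sum the value [0]. *)
Lemma reiter (eps : R) : amenable R G -> 0 < eps ->
  exists s, nonneg_weights s /\
  multi_norm (combination s) < eps * total_mass s.
Proof.
move=> [phi [phi_pos phi1 phi_inv]] eps0; apply: contrapT => /forallNP noR.
have {}noR s : nonneg_weights s -> eps * total_mass s <=
  multi_norm (combination s).
  by move=> s0; rewrite leNgt; apply/negP => h; apply: (noR s).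
pose K (v : 'I_m -> {poly R}) a := exists s, [/\ nonneg_weights s,
  v = combination s & a = eps * total_mass s].
have [||L [LD LN LM LK]] := @hahn_banach_cone R ('I_m ->
  {poly R}) multi_norm K sublinear_multi_norm.
- split=> [|_ _ _ _ [s [s0 -> ->]] [t [t0 -> ->]]|a _ _ a0 [s [s0 -> ->]]].
  + by exists [::]; rewrite /combination /total_mass !big_nil mulr0.
  + exists (s ++ t); rewrite /combination /total_mass !big_cat mulrDr;
      split => // x.
    by rewrite mem_cat => /orP[/s0|/t0].
  + exists [seq (a * x.1, x.2) | x <- s]; split.
    * by move=> _ /mapP[x /s0 x0 ->] /=; rewrite mulr_ge0.
    * rewrite /combination big_map scaler_sumr; apply: eq_bigr => x _.
      by rewrite scalerA.
    * by rewrite /total_mass big_map/= mulrCA -mulr_sumr.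
- by move=> _ _ [s [s0 -> ->]]; exact: noR.
pose f k n := L (single k 'X^n).
have f1 k n : `|f k n| <= 1.
  have h := LM (single k 'X^n); have h' := LM (- single k 'X^n).
  have nN : multi_norm (- single k 'X^n) = 1.
    rewrite -(multi_norm_single k n) /multi_norm; apply: eq_bigr => i _.
    rewrite /poly_norm [(- _) i]/(- (single k 'X^n i)) size_polyN.
    by apply: eq_bigr => j _; rewrite coefN normrN.
  rewrite LN nN multi_norm_single in h h' *.
  by rewrite ler_norml -/(f k n) lerNl h' h.
have Lsum (I : Type) (r : seq I) (F : I -> 'I_m -> {poly R}) :
    L (\sum_(i <- r) F i) = \sum_(i <- r) L (F i).
  have L0 : L 0 = 0 by have := LD 0 0; rewrite addr0 => h; lra.
  by elim: r => [|i r IH]; rewrite ?big_nil// !big_cons LD IH.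
have fE n : eps <= \sum_k (f k (lmul_index k n) - f k n).
  have -> : \sum_k (f k (lmul_index k n) - f k n) = L (point_displacement n).
    have -> : point_displacement n =
      \sum_k (single k 'X^(lmul_index k n) - single k 'X^n).
      apply/funext => k; rewrite fct_sumE.
      rewrite (eq_bigr (fun i => if i == k then 'X^(lmul_index i n) - 'X^n else
        0)).
        by rewrite -big_mkcond/= big_pred1_eq.
      move=> i _; rewrite -[LHS]/(single i _ k - single i _ k) /single eq_sym.
      by case: ifP => _; rewrite ?subrr.
    by rewrite Lsum; apply: eq_bigr => k _; rewrite LD LN.
  have := LK (point_displacement n) eps; apply; exists [:: (1, n)]; split.
  - by move=> x; rewrite inE => /eqP ->.
  - by rewrite /combination big_seq1 scale1r.
  - by rewrite /total_mass big_seq1 mulr1.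
have hP k : (fun x : G => (f k (e' x))%:C%C : R[i]^o) \in linfty_pred R G.
  apply/linfty_predP; exists 1 => x.
  by rewrite normc_def/= expr0n addr0 sqrtr_sqr lecR.
pose h k : linfty R G := Linfty (hP k).
pose F0 : linfty R G := \sum_k (ltrans (g k)^-1%g (h k) - h k) - eps%:C%C *:
  linfty1 R G.
have F0E x : F0 x = (\sum_k (f k (lmul_index k (e' x)) - f k (e' x)) -
  eps)%:C%C.
  have sumE (F : 'I_m -> linfty R G) : (\sum_k F k) x = \sum_k F k x.
    by apply: (big_morph (fun u : linfty R G => u x)).
  rewrite -[LHS]/((\sum_k (ltrans (g k)^-1%g (h k) - h k)) x - eps%:C%C * 1).
  rewrite mulr1 rmorphB/= sumE rmorph_sum/=; congr (_ - _);
    apply: eq_bigr => k _.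
  rewrite -[LHS]/((f k (e' ((g k)^-1^-1 * x)%g))%:C%C - (f k (e' x))%:C%C).
  by rewrite invgK rmorphB /lmul_index e'K.
have : 0 <= phi F0.
  apply: phi_pos => x; rewrite F0E ler0c subr_ge0; exact: fE.
rewrite /F0 linearB/= linear_sum big1 => [|k _]; last first.
  by rewrite linearB/= phi_inv subrr.
by rewrite linearZ/= phi1 sub0r mulr1 oppr_ge0 -[0]/((0 :
  R)%:C%C) lecR leNgt eps0.
Qed.

End Reiter.

Section ReiterToAlmostInvariant.
Variables (R : realType) (G : groupType) (e : nat -> G) (e' : G -> nat).
Hypotheses (eK : cancel e e') (e'K : cancel e' e).

Local Notation lam := (regular R eK e'K).

Definition sqrt_vector (p : {poly R}) : ell2 R :=
  trunc (fun i => (Num.sqrt p`_i)%:C%C) (size p).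

Lemma sqrt_vectorE (p : {poly R}) i : sqrt_vector p i = (Num.sqrt p`_i)%:C%C.
Proof.
rewrite truncE; case: ltnP => // pi.
by rewrite nth_default// sqrtr0.
Qed.

Lemma ell2_nsq_sqrt_vector (p : {poly R}) :
  (forall i, 0 <= p`_i) -> ell2_nsq (sqrt_vector p) = p.[1].
Proof.
move=> p0; rewrite ell2_nsq_trunc horner_coef; apply: eq_bigr => i _.
by rewrite /sqm/= expr0n addr0 sqr_sqrtr// expr1n mulr1.
Qed.

Lemma sqrt_subsq_le (x y : R) : 0 <= x -> 0 <= y ->
  (Num.sqrt x - Num.sqrt y) ^+ 2 <= `|x - y|.
Proof.
move=> x0 y0; rewrite -{2}(sqr_sqrtr x0) -{2}(sqr_sqrtr y0).
have := sqrtr_ge0 x; have := sqrtr_ge0 y.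
move: (Num.sqrt x) (Num.sqrt y) => a b b0 a0.
rewrite subr_sqr normrM -(real_normK (num_real (a - b))) expr2.
rewrite ler_wpM2l// (ger0_norm (addr_ge0 a0 b0)).
by rewrite ler_norml; apply/andP; split; lra.
Qed.

(** Square roots turn the l1 distance into the square of the l2 distance, as
    [(sqrt x - sqrt y) ^+ 2 <= `|x - y|]. *)
Lemma translate_sqrt_vector_le (g : G) (p q : {poly R}) :
  (forall i, 0 <= p`_i) ->
  (forall j, q`_j = p`_(lmulV_index e e' g j) - p`_j) ->
  ell2_nsq (translate eK e'K g (sqrt_vector p) - sqrt_vector p) <= poly_norm q.
Proof.
move=> p0 qE; apply: ell2_nsq_le => n; apply: le_trans (poly_norm_ge q n).
apply: ler_sum => j _.
rewrite ell2DE ell2NE translateE !sqrt_vectorE -rmorphB/= /sqm/= expr0n addr0.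
by rewrite qE; exact: sqrt_subsq_le.
Qed.

Lemma amenable_almost_invariant : amenable R G -> almost_invariant lam.
Proof.
move=> am F eps eps0; pose g (k : 'I_(size F)) := tnth (in_tuple F) k.
have [s [s0 hs]] := reiter e'K g am eps0.
pose p : {poly R} := \sum_(x <- s) x.1 *: 'X^(x.2).
have pE j : p`_j = \sum_(x <- s) x.1 * (j == x.2)%:R.
  by rewrite /p coef_sum; apply: eq_bigr => x _; rewrite coefZ coefXn.
have p0 j : 0 <= p`_j.
  by rewrite pE big_seq sumr_ge0// => x /s0 x0; rewrite mulr_ge0.
have p1 : p.[1] = total_mass s.
  by rewrite /p horner_sum; apply: eq_bigr => x _;
    rewrite !hornerE expr1n mulr1.
have cE k j : (combination e e' g s k)`_j =
  p`_(lmulV_index e e' (g k) j) - p`_j.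
  rewrite /combination fct_sumE coef_sum !pE -sumrB; apply: eq_bigr => x _.
  rewrite -[LHS]/((x.1 *: ('X^(lmul_index e e' g k x.2) - 'X^(x.2)))`_j).
  rewrite coefZ coefB !coefXn mulrBr; congr (_ * _%:R - _).
  rewrite -(can_eq eK) e'K -(can_eq eK (lmulV_index e e' (g k) j)) e'K.
  by congr nat_of_bool; apply/eqP/eqP => [->|<-]; rewrite ?mulKg ?mulVKg.
set m := total_mass s in hs p1.
have m0 : 0 < m.
  rewrite -(pmulr_rgt0 _ eps0); apply: le_lt_trans hs.
  by apply: sumr_ge0 => k _; apply: sumr_ge0.
set xi := sqrt_vector p.
have nxi : ell2_nsq xi = m by rewrite ell2_nsq_sqrt_vector.
pose t := (Num.sqrt m)^-1.
have t2 : t ^+ 2 * m = 1 by rewrite exprVn sqr_sqrtr ?(ltW m0)// mulVf// gt_eqF.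
have sqt : sqm t%:C%C = t ^+ 2 by rewrite /sqm/= expr0n addr0.
exists (t%:C%C *: xi : ell2 R); split.
  by rewrite nsq_ell2 ell2_nsqZ sqt nxi.
rewrite (eq_bigr (fun h => t ^+ 2 * ell2_nsq (translate eK e'K h xi - xi)));
  last first.
  by move=> h _; rewrite regularE linearZ/= -scalerBr nsq_ell2 ell2_nsqZ sqt.
rewrite -mulr_sumr.
have h : \sum_(h <- F) ell2_nsq (translate eK e'K h xi - xi) < eps * m.
  apply: le_lt_trans hs; rewrite big_tnth; apply: ler_sum => k _.
  exact: translate_sqrt_vector_le.
have tp : 0 < t ^+ 2 by rewrite exprn_gt0// invr_gt0 sqrtr_gt0.
by rewrite -(ltr_pM2l tp) mulrCA t2 mulr1 in h.
Qed.

End ReiterToAlmostInvariant.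

(** * The equivalence *)

Theorem theorem2p8 (R : realType) (G : groupType)
    (G_countable : ([set: G] #= [set: nat])%card) :
  [<-> amenable R G;
       exists (H : hilbertSpace R) (pi : unitary_rep G H),
         (exists w, onb_vector pi w) /\ trivial_weakly_contained pi;
       exists (H : hilbertSpace R) (pi : unitary_rep G H),
         (exists w, parseval_frame_vector pi w) /\ trivial_weakly_contained pi;
       exists (H : hilbertSpace R) (pi : unitary_rep G H),
         (exists w, frame_vector pi w) /\ trivial_weakly_contained pi;
       exists (H : hilbertSpace R) (pi : unitary_rep G H),
         (exists w, weak_frame_vector pi w) /\ trivial_weakly_contained pi;
       exists (H : hilbertSpace R) (pi : unitary_rep G H),
         trivial_weakly_contained pi /\
         exists w : H, total_family (orbit_family pi w) /\
           exists D : {pred H},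
             [/\ submod_closed D, dense [set` D]
               & forall v, v \in D ->
                   (frame_sum (orbit_family pi w) v < +oo)%E]].
Proof.
have [e' [e [eK e'K]]] : exists (e' : G -> nat) (e :
  nat -> G), cancel e e' /\ cancel e' e.
  have /card_set_bijP[f [_ finj fsurj]] := G_countable.
  have /choice[h hK] : forall n, exists x, f x = n.
    by move=> n; have [x _ <-] := fsurj n I; exists x.
  exists f, h; split => [//|x].
  by apply: finj; rewrite ?inE// hK.
tfae.
- move=> am; exists (ell2H R), (regular R eK e'K); split.
    by exists (delta R (e' 1%g) : ell2H R); exact: regular_onb.
  apply: (almost_invariant_weakly_contained e'K).
  exact: amenable_almost_invariant.
- move=> [H [pi [[w wP] pi1]]]; exists H, pi; split => //.
  by exists w; exact: orthonormal_basis_parseval.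
- move=> [H [pi [[w wP] pi1]]]; exists H, pi; split => //.
  by exists w; exact: parseval_frame_frame.
- move=> [H [pi [[w wP] pi1]]]; exists H, pi; split => //.
  by exists w; exact: frame_weak_frame.
- move=> [H [pi [[w [wB wT]] pi1]]]; exists H, pi; split => //.
  exists w; split => //; exists (fun=> true); split => [|O [x Ox] _|v _].
  + by split.
  + by exists x.
  + exact: bessel_fin.
move=> [H [pi [pi1 [w [wT [D [_ Dd Df]]]]]]].
apply: (almost_invariant_amenable (eK := eK) (e'K := e'K)).
apply: (almost_invariant_regular eK e'K wT Dd Df).
exact: weakly_contained_almost_invariant.
Qed.
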